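(* Let $A$ be a unital operator algebra. Assume that, for some $\varepsilon>0$, any morphism $u\colon A\to B(H)$ ($H$ an arbitrary Hilbert space) with $\|u\|\le 1+\varepsilon$ is completely bounded. Then necessarily the same property holds for all $\varepsilon>0$ (i.e. every bounded morphism $u\colon A\to B(H)$ is completely bounded), and hence $d(A)<\infty$.
   Context: A unital operator algebra is a closed unital subalgebra of some $B(H_0)$, not necessarily self-adjoint. A morphism is a unital homomorphism. Similarity degree: $d(A)=\infty$ if some bounded morphism $u\colon A\to B(H)$ is not completely bounded; otherwise $d(A)$ is the smallest (nonnegative) integer $d$ for which there is a constant $K$ with $\|u\|_{cb}\le K\|u\|^d$ for all Hilbert spaces $H$ and all bounded morphisms $u\colon A\to B(H)$. *)

(* Defs.v *)
From HB Require Import structures.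
From mathcomp Require Import all_boot all_order all_algebra.
From mathcomp Require Import complex.
From mathcomp Require Import all_classical all_reals all_analysis.
Set Implicit Arguments.
Unset Strict Implicit.
Unset Printing Implicit Defensive.
Import Order.TTheory GRing.Theory Num.Theory.
Import numFieldNormedType.Exports.
Local Open Scope classical_set_scope.
Local Open Scope ring_scope.

(* Complex Hilbert spaces. The library norm of a normed module over R[i] takes
   values in R[i] (it is a nonnegative real there); the form is linear in its
   first argument and conjugate-linear in the second. *)
HB.mixin Record CompleteNormedModule_isHilbert (R : realType) H
    of CompleteNormedModule R[i] H := {
  hdot : {dot H for (@Num.conj R[i])} ;
  hdotE : forall x : H, hdot x x = `|x| ^+ 2 }.

#[short(type="hilbertType")]
HB.structure Definition Hilbert (R : realType) :=
  {H of CompleteNormedModule_isHilbert R H & CompleteNormedModule R[i] H}.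

Definition hnorm (R : realType) (H : hilbertType R) (x : H) : R :=
  complex.Re `|x|.

(* Operators are plain functions H -> H, with the pointwise R[i]-module
   structure. *)
Definition opnorm (R : realType) (H : hilbertType R) (T : H -> H) : \bar R :=
  ereal_sup [set (hnorm (T x))%:E | x in [set x : H | hnorm x <= 1]].

Definition bounded_operator (R : realType) (H : hilbertType R) : set (H -> H) :=
  [set T | linear T /\ (opnorm T < +oo)%E].

(* Norm of a matrix of operators acting on the Hilbert space direct sum of n
   copies of H, i.e. the norm of M_n(B(H)) = B(H^n). *)
Definition mxopnorm (R : realType) (H : hilbertType R) (n : nat)
    (a : 'M[H -> H]_n) : \bar R :=
  ereal_sup
    [set (Num.sqrt (\sum_i hnorm (\sum_j a i j (x j)) ^+ 2))%:E
      | x in [set x : 'I_n -> H | \sum_j hnorm (x j) ^+ 2 <= 1]].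

Record unital_operator_algebra (R : realType) (H0 : hilbertType R)
    (A : set (H0 -> H0)) : Prop := {
  opalg_bounded : A `<=` @bounded_operator R H0 ;
  opalg_id : A idfun ;
  opalg_lin : forall (k : R[i]) a b, A a -> A b -> A (k *: a + b) ;
  opalg_comp : forall a b, A a -> A b -> A (a \o b) ;
  opalg_closed : forall T : H0 -> H0, bounded_operator T ->
    (forall e : R, 0 < e -> exists2 a, A a & (opnorm (T - a)%R < e%:E)%E) ->
    A T }.

(* A map A -> B(H) is encoded as a function on all of H0 -> H0 whose values
   outside A are irrelevant: everything below only looks at u on A. *)
Record morphism (R : realType) (H0 : hilbertType R) (A : set (H0 -> H0))
    (H : hilbertType R) (u : (H0 -> H0) -> (H -> H)) : Prop := {
  morphism_bounded_operator : forall a, A a -> bounded_operator (u a) ;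
  morphism_id : u idfun = idfun ;
  morphism_lin : forall (k : R[i]) a b, A a -> A b ->
    u (k *: a + b) = k *: u a + u b ;
  morphism_comp : forall a b, A a -> A b -> u (a \o b) = u a \o u b }.

Definition mnorm (R : realType) (H0 : hilbertType R) (A : set (H0 -> H0))
    (H : hilbertType R) (u : (H0 -> H0) -> (H -> H)) : \bar R :=
  ereal_sup [set opnorm (u a) | a in [set a | A a /\ (opnorm a <= 1)%E]].

(* The norm of u_n : M_n(A) -> M_n(B(H)), [a_ij] |-> [u(a_ij)]. *)
Definition mnorm_amp (R : realType) (H0 : hilbertType R) (A : set (H0 -> H0))
    (H : hilbertType R) (u : (H0 -> H0) -> (H -> H)) (n : nat) : \bar R :=
  ereal_sup [set mxopnorm (map_mx u a) | a in
    [set a : 'M[H0 -> H0]_n |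
      (forall i j, A (a i j)) /\ (mxopnorm a <= 1)%E]].

Definition cbnorm (R : realType) (H0 : hilbertType R) (A : set (H0 -> H0))
    (H : hilbertType R) (u : (H0 -> H0) -> (H -> H)) : \bar R :=
  ereal_sup [set mnorm_amp A u n | n in [set: nat]].

Definition bounded_morphism (R : realType) (H0 : hilbertType R)
    (A : set (H0 -> H0)) (H : hilbertType R) (u : (H0 -> H0) -> (H -> H)) : Prop :=
  morphism A u /\ (mnorm A u < +oo)%E.

Definition completely_bounded (R : realType) (H0 : hilbertType R)
    (A : set (H0 -> H0)) (H : hilbertType R) (u : (H0 -> H0) -> (H -> H)) : Prop :=
  (cbnorm A u < +oo)%E.

Definition similarity_bound (R : realType) (H0 : hilbertType R)
    (A : set (H0 -> H0)) (d : nat) : Prop :=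
  exists K : R, forall (H : hilbertType R) (u : (H0 -> H0) -> (H -> H)),
    bounded_morphism A u -> (cbnorm A u <= K%:E * mnorm A u ^+ d)%E.

(* The infimum is over a set of natural numbers, hence is its smallest element
   (and is +oo if that set is empty). *)
Definition similarity_degree (R : realType) (H0 : hilbertType R)
    (A : set (H0 -> H0)) : \bar R :=
  if `[< exists (H : hilbertType R) (u : (H0 -> H0) -> (H -> H)),
           bounded_morphism A u /\ ~ completely_bounded A u >]
  then +oo%E
  else ereal_inf [set d%:R%:E | d in [set d : nat | similarity_bound A d]].

Definition cb_up_to (R : realType) (H0 : hilbertType R) (A : set (H0 -> H0))
    (c : R) : Prop :=
  forall (H : hilbertType R) (u : (H0 -> H0) -> (H -> H)),
    morphism A u -> (mnorm A u <= c%:E)%E -> completely_bounded A u.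

(* Main.v *)
Require Import Defs.
From HB Require Import structures.
From mathcomp Require Import all_boot all_order all_algebra.
From mathcomp Require Import complex.
From mathcomp Require Import all_classical all_reals all_analysis.
From mathcomp Require Import ring lra.
Set Implicit Arguments.
Unset Strict Implicit.
Unset Printing Implicit Defensive.
Import Order.TTheory GRing.Theory Num.Theory.
Import numFieldNormedType.Exports.
Local Open Scope classical_set_scope.
Local Open Scope ring_scope.

(** Let [c = 1 + eps], let [e_j] be the unit rows of [A^n], and let [x] be in the unit ball
of [M_n(A)], with rows [x_i]. Call a quadratic form [Q] (the square of a Hilbertian
seminorm) on [A^n] admissible when [Q (a b) <= c ^+ 2 * Q b] for all contractions [a] of
[A] and [\sum_j Q (e_j) = 1]. Left multiplication on the Hilbert space of such a [Q] is a
morphism of norm at most [c]. These morphisms are completely bounded by hypothesis, and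
uniformly so because a bad sequence of forms could be put into one direct sum; so there is
[lam] with [\sum_i Q (x_i) <= lam] for all [n], [x] and admissible [Q]
([uniform_factorization]).

This bound is a statement about a convex cone, and separation turns it into an algebraic
certificate ([quadratic_separation]): there are contractions [a_k] and rows [b_k], [w_l]
such that every linear functional [phi] on rows satisfies
[lam * \sum_j |phi e_j|^2 = \sum_i |phi x_i|^2
   + \sum_k (c^2 |phi b_k|^2 - |phi (a_k b_k)|^2) + \sum_l |phi w_l|^2].
Two finite families with the same sum of squares under all functionals are related by a
contractive scalar matrix ([gram_factorization]), whence a contraction [W] with
[(x, c b) = W (sqrt lam e, a b)] ([sos_factorization]).

The lower half of that equation determines [b] as the limit of the iteration
[b' = c^-1 W_2 (sqrt lam e, a b)] started at zero. After [s] steps the upper half gives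
a polynomial of degree at most [s] in the [a_k] which approximates [x] in [M_n(A)] up to an
error of order [c ^- s], since the [a_k] are contractions ([remainder_energy]). A morphism
[u] with [|u| <= C] and [1 <= C] sends each [a_k] to an operator of norm at most [C], so
that it sends that polynomial to an operator of squared norm at most [M = lam (s + 1) C ^ (2 (s + 1))]
([truncation_energy]). Choosing [s], depending only on [c] and [lam], so that the error is
at most [1 / 2], the squared norm [S] of the [n]-th amplification of [u] satisfies
[S <= 2 M + S / 2]; as it is finite, [S <= 4 M] for all [n] ([factorizes_bound]). This is
complete boundedness with the polynomial estimate [K * C ^ (s + 1)], hence a finite
similarity degree.

The Hilbert spaces are completions of spaces with a quadratic form. Here the completion is
the bidual: the bounded real functionals on any such space form a Hilbert space, by the
theorem of Jordan and von Neumann, and transposing twice makes left multiplication act on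
the bidual without loss of norm. *)

(** * Families of vectors with the same sum of squares *)

Section GramFactor.
Variables (C : numClosedFieldType) (V : lmodType C).

Definition gram (I : finType) (v : I -> V) (phi psi : V -> C) : C :=
  \sum_i phi (v i) * (psi (v i))^*.

Definition orthonormal_system (I : finType) (v : I -> V) (r : nat) (psi : 'I_r -> V -> C) :=
  (forall a, scalar (psi a)) /\ forall a b, gram v (psi a) (psi b) = (a == b)%:R.

Lemma scalar_addZ (phi psi : V -> C) (k : C) : scalar phi -> scalar psi ->
  scalar (fun v => phi v + k * psi v).
Proof. by move=> hp hq t u v; rewrite hp hq; ring. Qed.

Lemma scalar_sum (phi : V -> C) : scalar phi ->
  forall (I : finType) (k : I -> C) (v : I -> V),
  phi (\sum_i k i *: v i) = \sum_i k i * phi (v i).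
Proof.
move=> hp I k v; pose f : {scalar V} := HB.pack phi (GRing.isLinear.Build _ _ _ _ phi hp).
rewrite -[phi]/(f : V -> C) linear_sum; apply: eq_bigr => i _; exact: linearZ.
Qed.

(** Polarization: a sesquilinear form is determined by its diagonal. *)
Lemma gram_polarize (I J : finType) (y : I -> V) (z : J -> V) :
  (forall phi, scalar phi -> gram y phi phi = gram z phi phi) ->
  forall phi psi, scalar phi -> scalar psi -> gram y phi psi = gram z phi psi.
Proof.
move=> hS phi psi hp hq.
have gD (K : finType) (v : K -> V) (k : C) :
    gram v (fun x => phi x + k * psi x) (fun x => phi x + k * psi x) =
    gram v phi phi + k * k^* * gram v psi psi +
      (k^* * gram v phi psi + k * gram v psi phi).
  rewrite /gram !mulr_sumr -!big_split /=; apply: eq_bigr => i _.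
  by rewrite rmorphD rmorphM /=; ring.
have h1 := hS _ (scalar_addZ 1 hp hq); have hi := hS _ (scalar_addZ 'i hp hq).
rewrite !gD !hS // conjC1 conjCi in h1 hi.
move/addrI: h1; move/addrI: hi; rewrite !mul1r => hi h1.
have h2 : gram y phi psi - gram y psi phi = gram z phi psi - gram z psi phi.
  apply: (mulfI (x := - 'i)); first by rewrite oppr_eq0 neq0Ci.
  by rewrite !mulrBr [in LHS]mulNr [X in _ - X]mulNr opprK -mulNr hi; ring.
apply: (mulfI (x := 2)); first by rewrite pnatr_eq0.
have -> : 2 * gram y phi psi =
  (gram y phi psi + gram y psi phi) + (gram y phi psi - gram y psi phi) by ring.
by rewrite h1 h2; ring.
Qed.

(** The values of the functionals at the family are the orthonormal rows of a matrix with
[#|I|] columns. *)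
Lemma orthonormal_system_size (I : finType) (v : I -> V) r (psi : 'I_r -> V -> C) :
  orthonormal_system v psi -> (r <= #|I|)%N.
Proof.
move=> [_ hO].
pose M : 'M[C]_(r, #|I|) := \matrix_(a, j) psi a (v (enum_val j)).
apply: (@mulmx1_min _ _ _ M (map_mx Num.conj M^T)).
apply/matrixP => a b; rewrite !mxE -hO /gram.
rewrite (reindex (@enum_val I I)) /=; last by apply: onW_bij; exact: enum_val_bij.
by apply: eq_bigr => j _; rewrite !mxE.
Qed.

Lemma maximal_orthonormal_system (I : finType) (v : I -> V) :
  exists r, (exists psi : 'I_r -> V -> C, orthonormal_system v psi) /\
    forall r' (psi : 'I_r' -> V -> C), orthonormal_system v psi -> (r' <= r)%N.
Proof.
pose P r := `[< exists psi : 'I_r -> V -> C, orthonormal_system v psi >].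
have P0 : exists r, P r by exists 0%N; apply/asboolP; exists (fun _ _ => 0); split=> [] [].
have Pb r : P r -> (r <= #|I|)%N by move=> /asboolP[psi /orthonormal_system_size].
have [r /asboolP hr rmax] := ex_maxnP P0 Pb.
by exists r; split=> // r' psi hpsi; apply: rmax; apply/asboolP; exists psi.
Qed.

Lemma gram_herm (I : finType) (v : I -> V) phi psi :
  gram v psi phi = (gram v phi psi)^*.
Proof.
rewrite /gram rmorph_sum; apply: eq_bigr => i _.
by rewrite rmorphM /= conjCK mulrC.
Qed.

Lemma gram_ge_term (I : finType) (v : I -> V) phi i :
  `|phi (v i)| ^+ 2 <= gram v phi phi.
Proof.
rewrite /gram (bigD1 i) //= -normCK lerDl sumr_ge0 // => j _.
by rewrite -normCK exprn_ge0.
Qed.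

Hypothesis sepV : forall v : V, v != 0 -> exists2 phi, scalar phi & phi v != 0.

(** Otherwise some functional is nonzero on the difference of both sides. Subtracting its
projection on the system leaves a functional orthogonal to the system and nonzero at
[y i], hence of positive square sum along [y], and so along [z]; normalized, it would
extend the maximal system. *)
Lemma orthonormal_expansion (I J : finType) (y : I -> V) (z : J -> V) r
    (psi : 'I_r -> V -> C) :
  (forall phi, scalar phi -> gram y phi phi = gram z phi phi) ->
  orthonormal_system z psi ->
  (forall r' (psi' : 'I_r' -> V -> C), orthonormal_system z psi' -> (r' <= r)%N) ->
  forall i, y i = \sum_a psi a (y i) *: \sum_j (psi a (z j))^* *: z j.
Proof.
move=> hS [hpsi hO] rmax i.
(* the dual vector of [psi a]: [phi (g a)] is the inner product of [phi] with [psi a] *)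
pose g a := \sum_j (psi a (z j))^* *: z j.
have phig phi a : scalar phi -> phi (g a) = gram z phi (psi a).
  by move=> hphi; rewrite scalar_sum //; apply: eq_bigr => j _; rewrite mulrC.
apply/eqP; rewrite -subr_eq0; apply: contraT => /sepV [phi hphi nz].
set w := _ - _ in nz.
(* [chi] is [phi] minus its projection on the system *)
pose chi v := phi v + -1 * \sum_a phi (g a) * psi a v.
have hchi : scalar chi.
  apply: scalar_addZ => // t u v; rewrite mulr_sumr -big_split /=; apply: eq_bigr => a _.
  by rewrite (hpsi a); ring.
have chig a : chi (g a) = 0.
  rewrite /chi (bigD1 a) //= big1 ?addr0 => [|b ba].
    by rewrite (phig (psi a)) // hO eqxx mulr1 mulN1r subrr.
  by rewrite (phig (psi b)) // hO (negbTE ba) mulr0.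
have chiy : chi (y i) = phi w.
  have -> : y i = w + \sum_a psi a (y i) *: g a by rewrite subrK.
  have Dchi u v : chi (u + v) = chi u + chi v.
    by rewrite -[u in LHS]scale1r hchi mul1r.
  rewrite Dchi scalar_sum // [X in _ + X]big1 ?addr0; last by move=> a _; rewrite chig mulr0.
  rewrite /chi big1 ?mulr0 ?addr0 // => a _.
  have -> : psi a w = 0; last by rewrite mulr0.
  have -> : w = -1 *: (\sum_a psi a (y i) *: g a) + y i by rewrite scaleN1r addrC.
  rewrite hpsi scalar_sum // (bigD1 a) //= big1 ?addr0 => [|b ba].
    by rewrite phig // hO eqxx mulr1; ring.
  by rewrite phig // hO eq_sym (negbTE ba) mulr0.
have pos : 0 < gram z chi chi.
  rewrite -hS //; apply: lt_le_trans (gram_ge_term _ _ i).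
  by rewrite exprn_gt0 // normr_gt0 chiy.
pose s := sqrtC (gram z chi chi).
have s0 : 0 < s by rewrite sqrtC_gt0.
have ss : s^* = s by apply/CrealP/ger0_real/ltW.
pose psi' (a : 'I_r.+1) := if unlift ord_max a is Some b then psi b else fun v => s^-1 * chi v.
have gs (phi' : V -> C) : gram z (fun v => s^-1 * chi v) phi' = s^-1 * gram z chi phi'.
  by rewrite /gram mulr_sumr; apply: eq_bigr => j _; rewrite mulrA.
have cpsi a : gram z chi (psi a) = 0 by rewrite -phig // chig.
suff : orthonormal_system z psi' by move/rmax; rewrite ltnn.
split=> [a|a b]; rewrite /psi'.
  case: unliftP => // _ t u v.
  by rewrite hchi; ring.
case: (unliftP ord_max a) => [a'|] ->; case: (unliftP ord_max b) => [b'|] ->.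
- by rewrite hO (inj_eq (@lift_inj _ _)).
- by rewrite gram_herm gs cpsi mulr0 rmorph0 eq_sym (negbTE (neq_lift _ _)).
- by rewrite gs cpsi mulr0 (negbTE (neq_lift _ _)).
rewrite eqxx gs gram_herm gs rmorphM /= -gram_herm rmorphV ?unitfE ?gt_eqF //= ss.
have -> : gram z chi chi = s ^+ 2 by rewrite sqrtCK.
by field; rewrite gt_eqF.
Qed.

End GramFactor.

(** * Sums of squares of Hilbert space norms *)

Definition sqmod (R : realType) (k : R[i]) : R := complex.Re (`|k| ^+ 2).
Arguments sqmod : simpl never.

Lemma sqmod_toC (R : realType) (k : R[i]) : real_complex R (sqmod k) = `|k| ^+ 2.
Proof. by rewrite /sqmod RRe_real // ger0_real // exprn_ge0. Qed.

Section HilbertNorm.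
Variables (R : realType) (H : hilbertType R).
Implicit Types (x y : H) (k : R[i]).
Local Notation C := R[i].
Local Notation toC := (real_complex R).

Lemma hnorm_toC x : toC (hnorm x) = `|x|.
Proof. by rewrite /hnorm RRe_real // ger0_real. Qed.

Lemma hnorm_ge0 x : 0 <= hnorm x.
Proof. by rewrite -ler0c hnorm_toC. Qed.

Lemma hnorm_sqr_toC x : toC (hnorm x ^+ 2) = hdot x x.
Proof. by rewrite rmorphXn /= hnorm_toC hdotE. Qed.

Lemma hdot_suml (I : finType) (k : I -> C) (x : I -> H) y :
  hdot (\sum_i k i *: x i) y = \sum_i k i * hdot (x i) y.
Proof. by rewrite linear_sumlz; apply: eq_bigr => i _; rewrite linearZl_LR. Qed.

Lemma hdot_sumr (I : finType) (k : I -> C) (x : I -> H) y :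
  hdot y (\sum_i k i *: x i) = \sum_i (k i)^* * hdot y (x i).
Proof. by rewrite linear_sumr; apply: eq_bigr => i _; rewrite linearZr_LR. Qed.

Lemma hnorm_sum_isometry (I A : finType) (m : I -> A -> C) (t : A -> H) :
  (forall a b, \sum_i m i a * (m i b)^* = (a == b)%:R) ->
  \sum_i hdot (\sum_a m i a *: t a) (\sum_a m i a *: t a) = \sum_a hdot (t a) (t a).
Proof.
move=> hm.
under eq_bigr => i _.
  rewrite hdot_suml; under eq_bigr => a _ do rewrite hdot_sumr mulr_sumr.
  over.
rewrite exchange_big; apply: eq_bigr => a _; rewrite exchange_big /=.
rewrite (bigD1 a) //= [X in _ + X]big1 ?addr0 => [|b ba].
  under eq_bigr => i _ do rewrite mulrA.
  by rewrite -mulr_suml hm eqxx mul1r.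
under eq_bigr => i _ do rewrite mulrA.
by rewrite -mulr_suml hm eq_sym (negbTE ba) mul0r.
Qed.

(** Bessel inequality, from the positivity of the squared distance from [h] to its
projection on the columns of [u]. *)
Lemma hnorm_bessel (J A : finType) (u : J -> A -> C) (h : J -> H) :
  (forall a b, \sum_j u j a * (u j b)^* = (a == b)%:R) ->
  \sum_a hdot (\sum_j (u j a)^* *: h j) (\sum_j (u j a)^* *: h j) <= \sum_j hdot (h j) (h j).
Proof.
move=> hu; set t := fun a => \sum_j (u j a)^* *: h j.
pose p j := \sum_a u j a *: t a.
have hp : \sum_j hdot (p j) (p j) = \sum_a hdot (t a) (t a) by exact: hnorm_sum_isometry.
have hhp : \sum_j hdot (h j) (p j) = \sum_a hdot (t a) (t a).
  under eq_bigr => j _ do rewrite hdot_sumr.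
  by rewrite exchange_big; apply: eq_bigr => a _; rewrite [RHS]hdot_suml.
have hph : \sum_j hdot (p j) (h j) = \sum_a hdot (t a) (t a).
  under eq_bigr => j _ do rewrite hdot_suml.
  rewrite exchange_big; apply: eq_bigr => a _; rewrite [RHS]hdot_sumr.
  by apply: eq_bigr => j _; rewrite conjCK.
have : 0 <= \sum_j hdot (h j - p j) (h j - p j).
  by apply: sumr_ge0 => j _; rewrite hdotE exprn_ge0.
under eq_bigr => j _ do rewrite linearBl !linearBr.
by rewrite !sumrB hp hhp hph subrr subr0 subr_ge0.
Qed.

Lemma hnormsqZ k x : hnorm (k *: x) ^+ 2 = sqmod k * hnorm x ^+ 2.
Proof.
apply: complexI; rewrite [RHS]rmorphM /= !hnorm_sqr_toC linearZl_LR linearZr_LR /=.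
by rewrite sqmod_toC normCK mulrA.
Qed.

Lemma hnormsq_parallelogram x y :
  hnorm (x + y) ^+ 2 + hnorm (x - y) ^+ 2 = 2 * (hnorm x ^+ 2 + hnorm y ^+ 2).
Proof.
apply: complexI; rewrite mulr_natl [LHS]rmorphD [RHS]rmorphMn [in RHS]rmorphD /=.
rewrite !hnorm_sqr_toC linearDl linearBl !linearDr !linearNr.
by ring.
Qed.

End HilbertNorm.

(** The matrix is the partial isometry [\sum_a psi_a(y_i) (psi_a(z_j))^*], for an
orthonormal system maximal with respect to [z]: its two factors are isometric and
co-isometric. Its action on vectors of any Hilbert space is contractive for the same
reason as on scalars, which is how complete boundedness enters. *)
Lemma gram_factorization (R : realType) (V : lmodType R[i]) (I J : finType)
    (y : I -> V) (z : J -> V) :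
  (forall v : V, v != 0 -> exists2 phi, scalar phi & phi v != 0) ->
  (forall phi, scalar phi -> gram y phi phi = gram z phi phi) ->
  exists W : I -> J -> R[i],
    (forall i, y i = \sum_j W i j *: z j) /\
    forall (H : hilbertType R) (h : J -> H),
      \sum_i hnorm (\sum_j W i j *: h j) ^+ 2 <= \sum_j hnorm (h j) ^+ 2.
Proof.
move=> sepV hS; have [r [[psi hpsi] rmax]] := maximal_orthonormal_system z.
have hE := orthonormal_expansion sepV hS hpsi rmax.
case: (hpsi) => psiS psiO.
exists (fun i j => \sum_a psi a (y i) * (psi a (z j))^*).
have WE (U : lmodType R[i]) (h : J -> U) i :
    \sum_j (\sum_a psi a (y i) * (psi a (z j))^*) *: h j =
    \sum_a psi a (y i) *: \sum_j (psi a (z j))^* *: h j.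
  under [RHS]eq_bigr => a _ do rewrite scaler_sumr.
  rewrite exchange_big; apply: eq_bigr => j _; rewrite scaler_suml.
  by apply: eq_bigr => a _; rewrite scalerA.
split=> [i|H h]; first by rewrite WE -hE.
rewrite -lecR !rmorph_sum /=.
under eq_bigr => i _ do rewrite WE hnorm_sqr_toC.
under [X in _ <= X]eq_bigr => j _ do rewrite hnorm_sqr_toC.
rewrite (@hnorm_sum_isometry _ _ _ _ (fun i a => psi a (y i))).
  exact: (hnorm_bessel (u := fun j a => psi a (z j))).
by move=> a b; rewrite -psiO -(gram_polarize hS).
Qed.

(** * Separation of a point from a convex cone *)

Section ConeSeparation.
Variables (R : realType) (F : lmodType R).

Record convex_cone (P : set F) : Prop := {
  cone_add : forall y z, P y -> P z -> P (y + z) ;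
  cone_scale : forall (t : R) y, 0 <= t -> P y -> P (t *: y) }.

Definition order_bounded (P : set F) (e y : F) :=
  exists t : R, P (t *: e - y) /\ P (t *: e + y).

Section MaximalCone.
Variables (M : set F) (e : F).
Hypotheses (cM : convex_cone M) (Me : M e) (MNe : ~ M (- e))
  (totM : forall y, M y \/ M (- y)).

(** On a maximal cone the separating functional is this Dedekind cut. *)
Definition cone_level (y : F) : R := sup [set t : R | M (y - t *: e)].

Lemma cone_unit_ge0 (t : R) : M (t *: e) -> 0 <= t.
Proof.
move=> Mt; rewrite leNgt; apply/negP => t0; apply: MNe.
have -> : - e = (- t)^-1 *: (t *: e).
  by rewrite scalerA invrN mulNr mulVf ?lt_eqF // scaleN1r.
by apply: (cone_scale cM) => //; rewrite invr_ge0 oppr_ge0 ltW.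
Qed.

Lemma cone_level_ubound y t s : M (y - t *: e) -> M (s *: e - y) -> t <= s.
Proof.
move=> h1 h2; rewrite -subr_ge0; apply: cone_unit_ge0; rewrite scalerBl.
by rewrite -(subrKA y) addrC; apply: (cone_add cM); rewrite // addrC.
Qed.

Lemma cone_level_has_sup y : order_bounded M e y -> has_sup [set t : R | M (y - t *: e)].
Proof.
move=> [s [h1 h2]]; split; last by exists s => t /= ht; exact: cone_level_ubound ht h1.
by exists (- s) => /=; rewrite scaleNr opprK addrC.
Qed.

Lemma cone_level_ge y t : order_bounded M e y -> M (y - t *: e) -> t <= cone_level y.
Proof. by move=> /cone_level_has_sup [_ hb] ht; exact: ub_le_sup. Qed.

Lemma cone_level_le y t : order_bounded M e y -> M (t *: e - y) -> cone_level y <= t.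
Proof.
move=> /cone_level_has_sup [hn _] ht; apply: ge_sup => // s /= hs.
exact: cone_level_ubound hs ht.
Qed.

Lemma cone_level_lower y t : order_bounded M e y -> t < cone_level y -> M (y - t *: e).
Proof.
move=> /cone_level_has_sup hs tl.
have [s /= Ms ts] := sup_adherent (eps := cone_level y - t) ltac:(by rewrite subr_gt0) hs.
have -> : y - t *: e = (y - s *: e) + (s - t) *: e by rewrite scalerBl addrA subrK.
apply: (cone_add cM) => //; apply: (cone_scale cM) => //.
by rewrite subr_ge0 ltW // -(subKr (cone_level y) t).
Qed.

Lemma cone_level_upper y t : order_bounded M e y -> cone_level y < t -> M (t *: e - y).
Proof.
move=> hy lt; case: (totM (y - t *: e)); last by rewrite opprB.
by move=> /(cone_level_ge hy); rewrite leNgt lt.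
Qed.

Lemma cone_level_unique y l : order_bounded M e y ->
  (forall eps, 0 < eps -> M (y - (l - eps) *: e) /\ M ((l + eps) *: e - y)) ->
  cone_level y = l.
Proof.
move=> hy h; apply/eqP; rewrite eq_le; apply/andP; split; apply/ler_addgt0Pr => eps e0.
  by apply: cone_level_le => //; case: (h _ e0).
by rewrite -lerBlDr; apply: cone_level_ge => //; case: (h _ e0).
Qed.

Lemma cone_levelP y : order_bounded M e y ->
  forall eps, 0 < eps -> M (y - (cone_level y - eps) *: e) /\ M ((cone_level y + eps) *: e - y).
Proof.
move=> hy eps e0; split; first by apply: cone_level_lower => //; rewrite ltrBlDr ltrDl.
by apply: cone_level_upper => //; rewrite ltrDl.
Qed.

Lemma order_boundedD y z : order_bounded M e y -> order_bounded M e z ->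
  order_bounded M e (y + z).
Proof.
move=> [s [s1 s2]] [t [t1 t2]]; exists (s + t).
by rewrite scalerDl opprD addrACA [in X in _ /\ X]addrACA; split; exact: (cone_add cM).
Qed.

Lemma order_boundedN y : order_bounded M e y -> order_bounded M e (- y).
Proof. by move=> [s [s1 s2]]; exists s; rewrite opprK. Qed.

Lemma order_boundedZ (k : R) y : order_bounded M e y -> order_bounded M e (k *: y).
Proof.
have pos l z : 0 <= l -> order_bounded M e z -> order_bounded M e (l *: z).
  move=> l0 [s [s1 s2]]; exists (l * s).
  by rewrite -scalerA -scalerBr -scalerDr; split; exact: (cone_scale cM).
case: (leP 0 k) => k0 hy; first exact: pos.
by rewrite -[k]opprK scaleNr; apply: order_boundedN; apply: pos => //; rewrite oppr_ge0 ltW.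
Qed.

Lemma cone_levelD y z : order_bounded M e y -> order_bounded M e z ->
  cone_level (y + z) = cone_level y + cone_level z.
Proof.
move=> hy hz; apply: cone_level_unique; first exact: order_boundedD.
move=> eps e0; have e2 : 0 < eps / 2 by rewrite divr_gt0.
have [y1 y2] := cone_levelP hy e2; have [z1 z2] := cone_levelP hz e2.
have -> : cone_level y + cone_level z - eps = (cone_level y - eps / 2) + (cone_level z - eps / 2).
  by field.
have -> : cone_level y + cone_level z + eps = (cone_level y + eps / 2) + (cone_level z + eps / 2).
  by field.
split.
  by rewrite scalerDl opprD addrACA; exact: (cone_add cM).
by rewrite scalerDl opprD addrACA; exact: (cone_add cM).
Qed.

Lemma cone_levelN y : order_bounded M e y -> cone_level (- y) = - cone_level y.
Proof.
move=> hy; apply: cone_level_unique; first exact: order_boundedN.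
move=> eps e0; have [y1 y2] := cone_levelP hy e0.
rewrite -(opprD (cone_level y) eps) scaleNr opprK addrC; split=> //.
by rewrite opprK addrC -(opprK eps) -(opprD (cone_level y)) scaleNr.
Qed.

Lemma cone_levelZ k y : order_bounded M e y -> cone_level (k *: y) = k * cone_level y.
Proof.
have pos l z : 0 < l -> order_bounded M e z -> cone_level (l *: z) = l * cone_level z.
  move=> l0 hz; apply: cone_level_unique; first exact: order_boundedZ.
  move=> eps e0; have [z1 z2] := cone_levelP hz (divr_gt0 e0 l0).
  have -> : l * cone_level z - eps = l * (cone_level z - eps / l).
    by field; rewrite gt_eqF.
  have -> : l * cone_level z + eps = l * (cone_level z + eps / l).
    by field; rewrite gt_eqF.
  by rewrite -!scalerA -!scalerBr; split; apply: (cone_scale cM) => //; exact: ltW.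
move=> hy; case: (ltgtP k 0) => [k0|k0|->].
- rewrite -[k]opprK scaleNr cone_levelN; last exact: order_boundedZ.
  by rewrite pos ?oppr_gt0 // !mulNr.
- exact: pos.
have h0 := order_boundedZ 0 hy; rewrite mul0r.
have := cone_levelD h0 h0; rewrite -scalerDl addr0 => h.
by apply: (addrI (cone_level (0 *: y))); rewrite addr0 -h.
Qed.

End MaximalCone.

(** By the lemma of Zorn, applied to the cones that contain [P] and [- x] but not [- e]. If
neither [y] nor [- y] were in a maximal one, adding either ray would produce [- e], and a
convex combination of the two decompositions would show that [- e] was there already. *)
Lemma maximal_cone (P : set F) (e x : F) : convex_cone P -> P e ->
  order_bounded P e x -> ~ P x ->
  exists M : set F, [/\ convex_cone M, P `<=` M, M (- x), ~ M (- e) &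
    forall y, M y \/ M (- y)].
Proof.
move=> cP Pe [r [_ Prx]] nPx.
have P0 : P 0 by rewrite -(scale0r e); apply: (cone_scale cP).
have nPe : ~ P (- e).
  move=> PNe; apply: nPx; case: (leP 0 r) => r0.
    have -> : x = (r *: e + x) + r *: - e by rewrite scalerN addrAC subrr add0r.
    by apply: (cone_add cP) => //; exact: (cone_scale cP).
  have -> : x = (r *: e + x) + (- r) *: e by rewrite scaleNr addrAC subrr add0r.
  by apply: (cone_add cP) => //; apply: (cone_scale cP); rewrite // oppr_ge0 ltW.
(* the cone generated by [P] and [- x] *)
pose P1 : set F := [set y | exists2 p, P p & exists2 t : R, 0 <= t & y = p - t *: x].
have PP1 : P `<=` P1 by move=> p Pp; exists p => //; exists 0; rewrite // scale0r subr0.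
have P1x : P1 (- x) by exists 0 => //; exists 1; rewrite // scale1r add0r.
have cP1 : convex_cone P1.
  split=> [_ _ [p Pp [t t0 ->]] [q Pq [s s0 ->]]|t _ t0 [p Pp [s s0 ->]]].
    exists (p + q); first exact: (cone_add cP).
    by exists (t + s); [exact: addr_ge0|rewrite scalerDl opprD addrACA].
  exists (t *: p); first exact: (cone_scale cP).
  by exists (t * s); [exact: mulr_ge0|rewrite scalerBr scalerA].
have nP1e : ~ P1 (- e).
  move=> [p Pp [t t0 h]].
  have tx : t *: x = p + e by rewrite -[e]opprK h opprB addrC subrK.
  have [t00|tn0] := eqVneq t 0; first by apply: nPe; rewrite h t00 scale0r subr0.
  apply: nPx; have -> : x = t^-1 *: (p + e) by rewrite -tx scalerA mulVf // scale1r.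
  by apply: (cone_scale cP); [rewrite invr_ge0|exact: (cone_add cP)].
pose good (M : set F) := [/\ M = set0 \/ P1 `<=` M, convex_cone M & ~ M (- e)].
have [|M [[hM cM nMe] maxM]] := @Zorn_bigcup F good.
  move=> G Ggood Gtot; split.
  - case: (pselect (exists2 M, G M & P1 `<=` M)) => [[M GM PM]|nex].
      by right=> y /PM My; exists M.
    left; apply/seteqP; split=> // y [M GM My]; case: (Ggood _ GM) => -[M0|PM] _ _.
      by rewrite M0 in My.
    by case: nex; exists M.
  - split=> [y z [M GM My] [N GN Nz]|t y t0 [M GM My]].
      have [MN|NM] := Gtot _ _ GM GN.
        by exists N => //; case: (Ggood _ GN) => _ cN _; apply: (cone_add cN) => //; exact: MN.
      by exists M => //; case: (Ggood _ GM) => _ cM _; apply: (cone_add cM) => //; exact: NM.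
    by exists M => //; case: (Ggood _ GM) => _ cM _; exact: (cone_scale cM).
  - by move=> [M GM]; case: (Ggood _ GM).
have P1M : P1 `<=` M.
  case: hM => // M0; exfalso; apply: (maxM P1); last by split => //; right.
  by rewrite M0; split=> // /(_ (- x) P1x).
have Me : M e by apply: P1M; exact: PP1.
have M0 : M 0 by apply: P1M; exact: PP1.
exists M; split=> //; [by move=> p /PP1 /P1M|exact: P1M|].
have ext y : ~ M y -> exists2 m, M m & exists2 t : R, 0 < t & - e = m + t *: y.
  move=> nMy.
  pose N : set F := [set z | exists2 m, M m & exists2 t : R, 0 <= t & z = m + t *: y].
  have MN : M `<=` N by move=> m Mm; exists m => //; exists 0; rewrite // scale0r addr0.
  have Ny : N y by exists 0 => //; exists 1; rewrite // scale1r add0r.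
  have cN : convex_cone N.
    split=> [_ _ [p Pp [t t0 ->]] [q Pq [s s0 ->]]|t _ t0 [p Pp [s s0 ->]]].
      exists (p + q); first exact: (cone_add cM).
      by exists (t + s); [exact: addr_ge0|rewrite scalerDl addrACA].
    exists (t *: p); first exact: (cone_scale cM).
    by exists (t * s); [exact: mulr_ge0|rewrite scalerDr scalerA].
  have : ~ good N by apply: maxM; split=> // /(_ _ Ny).
  move=> ngood; case: (pselect (N (- e))) => [[m Mm [t t0 h]]|nNe].
    exists m => //; exists t => //; rewrite lt_neqAle t0 andbT; apply/eqP => t00.
    by apply: nMe; rewrite h -t00 scale0r addr0.
  by case: ngood; split=> //; right; exact: subset_trans MN.
move=> y; apply: contrapT => /not_orP [/ext [m Mm [t t0 h1]] /ext [n Mn [s s0 h2]]].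
apply: nMe; have -> : - e = (s + t)^-1 *: (s *: m + t *: n).
  have h : (s + t) *: - e = s *: m + t *: n.
    rewrite scalerDl {1}h1 h2 !scalerDr !scalerN !scalerA [t * s]mulrC.
    by rewrite addrACA subrr addr0.
  by rewrite -h scalerA mulVf ?scale1r // gt_eqF // addr_gt0.
apply: (cone_scale cM); first by rewrite invr_ge0 addr_ge0 // ltW.
by apply: (cone_add cM); apply: (cone_scale cM) => //; exact: ltW.
Qed.

(** The functional is linear only on the elements dominated by the unit [e]; elsewhere the
cut that defines it may be infinite. *)
Lemma cone_separation (P : set F) (e x : F) : convex_cone P -> P e ->
  order_bounded P e x -> ~ P x ->
  exists L : F -> R,
    [/\ forall y z, order_bounded P e y -> order_bounded P e z -> L (y + z) = L y + L z,
        forall k y, order_bounded P e y -> L (k *: y) = k * L y,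
        forall y, order_bounded P e y -> P y -> 0 <= L y,
        L e = 1 & L x <= 0].
Proof.
move=> cP Pe hx nPx; have [M [cM PM Mx MNe totM]] := maximal_cone cP Pe hx nPx.
have bM y : order_bounded P e y -> order_bounded M e y.
  by move=> [t [h1 h2]]; exists t; split; exact: PM.
have Me := PM _ Pe; have be : order_bounded M e e.
  exists 1; rewrite scale1r subrr; split; last exact: (cone_add cM).
  by rewrite -(scale0r e); exact: (cone_scale cM).
exists (cone_level M e); split.
- by move=> y z /bM hy /bM hz; exact: cone_levelD.
- by move=> k y /bM hy; exact: cone_levelZ.
- by move=> y /bM hy /PM My; apply: cone_level_ge => //; rewrite scale0r subr0.
- apply: cone_level_unique => // eps e0.
  have -> : e - (1 - eps) *: e = eps *: e by rewrite scalerBl scale1r opprB addrC subrK.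
  rewrite scalerDl scale1r addrAC subrr add0r.
  by split; apply: (cone_scale cM); rewrite // ltW.
by apply: cone_level_le => //; [exact: bM|rewrite scale0r add0r].
Qed.

End ConeSeparation.

(** * Quadratic forms and their polarization *)

Section QuadraticForms.
Variables (R : realType) (V : lmodType R[i]).
Local Notation toC := (real_complex R).

Record quadratic (Q : V -> R) : Prop := {
  quad_ge0 : forall x, 0 <= Q x ;
  quad_parallelogram : forall x y, Q (x + y) + Q (x - y) = 2 * (Q x + Q y) ;
  quadZ : forall k x, Q (k *: x) = sqmod k * Q x }.

Lemma sqmod_ge0 (k : R[i]) : 0 <= sqmod k.
Proof. by rewrite -ler0c sqmod_toC exprn_ge0. Qed.

Lemma sqmodM (k l : R[i]) : sqmod (k * l) = sqmod k * sqmod l.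
Proof. by apply: complexI; rewrite [RHS]rmorphM /= !sqmod_toC normrM exprMn. Qed.

Lemma sqmod_real (t : R) : sqmod (toC t) = t ^+ 2.
Proof.
apply: complexI; rewrite sqmod_toC normc_def /= expr0n addr0 sqrtr_sqr.
by rewrite -rmorphXn /= real_normK ?num_real.
Qed.

Lemma sqmod_i : sqmod ('i%C : R[i]) = 1.
Proof. by rewrite /sqmod -add_Re2_Im2 /= expr0n add0r expr1n. Qed.

Definition polar (Q : V -> R) (x y : V) : R := (Q (x + y) - Q (x - y)) / 4.

Section Polar.
Variables (Q : V -> R) (hQ : quadratic Q).

Lemma quad0 : Q 0 = 0.
Proof. by rewrite -(scale0r (0 : V)) (quadZ hQ) (sqmod_real 0) expr0n mul0r. Qed.

Lemma quadN x : Q (- x) = Q x.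
Proof.
rewrite -scaleN1r (quadZ hQ) -[-1 in LHS](rmorphN1 toC) /=.
by rewrite sqmod_real sqrrN expr1n mul1r.
Qed.

Lemma quad_real (t : R) x : Q (toC t *: x) = t ^+ 2 * Q x.
Proof. by rewrite (quadZ hQ) sqmod_real. Qed.

Lemma polarC x y : polar Q x y = polar Q y x.
Proof. by rewrite /polar [x + y]addrC -(quadN (x - y)) opprB. Qed.

Lemma polarxx x : polar Q x x = Q x.
Proof.
rewrite /polar subrr quad0 subr0 -[x in LHS]scale1r -scalerDl.
have -> : (1 + 1 : R[i]) = toC 2 by rewrite (rmorph_nat toC).
by rewrite quad_real; field.
Qed.

Lemma polar0l y : polar Q 0 y = 0.
Proof. by rewrite /polar add0r sub0r quadN subrr mul0r. Qed.

(** The parallelogram law, applied to [x + z], [y + z] and to [x - z], [y - z], compares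
[polar Q x z + polar Q y z] with [polar Q (x + y) (2 z) / 2]; taking [y = 0] removes the
factors two. *)
Lemma polarDl x y z : polar Q (x + y) z = polar Q x z + polar Q y z.
Proof.
have half a b c : 2 * (polar Q a c + polar Q b c) = polar Q (a + b) (c + c).
  have := quad_parallelogram hQ (a + c) (b + c).
  have := quad_parallelogram hQ (a - c) (b - c).
  rewrite !opprD !opprK [a - c + (b - c)]addrACA [a + c + (b + c)]addrACA.
  rewrite [a - c + (- b + c)]addrACA [a + c + (- b - c)]addrACA addNr subrr !addr0.
  by rewrite /polar -opprD => h1 h2; lra.
have dbl a c : polar Q a (c + c) = 2 * polar Q a c.
  by rewrite -[a in LHS]addr0 -half polar0l addr0.
have := half x y z; rewrite dbl => h; lra.
Qed.

Lemma polarNl x y : polar Q (- x) y = - polar Q x y.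
Proof.
have := polarDl x (- x) y; rewrite subrr polar0l => h; lra.
Qed.

(** An additive function commutes with integers, so that the defect at [t] multiplied by [n]
is the defect at the fractional part of [n t], which is bounded independently of [n]. *)
Lemma additive_bounded_linear (g : R -> R) (B : R) :
  (forall s t, g (s + t) = g s + g t) ->
  (forall t, 0 <= t <= 1 -> `|g t| <= B) -> forall t, g t = t * g 1.
Proof.
move=> gD gB t.
have g0 : g 0 = 0 by have := gD 0 0; rewrite addr0 => h; lra.
have gn n s : g (n%:R * s) = n%:R * g s.
  elim: n => [|n ih]; first by rewrite !mul0r.
  by rewrite -natr1 !mulrDl !mul1r gD ih.
have gN s : g (- s) = - g s by have := gD s (- s); rewrite subrr g0 => h; lra.
have gz (m : int) s : g (m%:~R * s) = m%:~R * g s.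
  by case: m => n; rewrite ?NegzE ?mulrNz ?mulNr ?gN -?pmulrn gn.
have key n : n%:R * `|g t - t * g 1| <= 2 * B.
  rewrite -[n%:R]ger0_norm ?ler0n // -normrM mulrBr -gn.
  set f := n%:R * t - (Num.floor (n%:R * t))%:~R.
  have /andP[f1 f2] : 0 <= f < 1.
    by rewrite /f subr_ge0 ge_floor /= ltrBlDl -[X in _ < _ + X]/(1%:~R) -intrD floorD1_gt.
  have -> : n%:R * (t * g 1) = (Num.floor (n%:R * t))%:~R * g 1 + f * g 1.
    by rewrite /f mulrBl addrC subrK mulrA.
  have -> : g (n%:R * t) = (Num.floor (n%:R * t))%:~R * g 1 + g f.
    by rewrite -gz mulr1 -gD /f addrC subrK.
  rewrite opprD addrACA subrr add0r; apply: le_trans (ler_normB _ _) _.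
  have b1 : `|g f| <= B by apply: gB; rewrite f1 ltW.
  have b2 : `|g 1| <= B by apply: gB; rewrite ler01 lexx.
  have : `|f * g 1| <= `|g 1|.
    by rewrite normrM ger0_norm // ler_piMl // ltW.
  by move=> b3; lra.
apply/eqP; rewrite -subr_eq0 -normr_le0 leNgt; apply/negP => d0.
have := key (Num.truncn (2 * B / `|g t - t * g 1|)).+1; rewrite leNgt => /negP; apply.
by rewrite -ltr_pdivrMr // truncnS_gt.
Qed.

Lemma polar_bound x y : `|polar Q x y| <= (Q x + Q y) / 2.
Proof.
have := quad_parallelogram hQ x y.
have := quad_ge0 hQ (x + y); have := quad_ge0 hQ (x - y).
by rewrite /polar ler_norml => h1 h2 h3; apply/andP; split; lra.
Qed.

Lemma polarZl (t : R) x y : polar Q (toC t *: x) y = t * polar Q x y.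
Proof.
pose g s := polar Q (toC s *: x) y.
have -> : polar Q x y = g 1 by rewrite /g scale1r.
rewrite -/(g t); apply: (@additive_bounded_linear g ((Q x + Q y) / 2)).
  by move=> a b; rewrite /g rmorphD scalerDl polarDl.
move=> s /andP[s0 s1]; apply: le_trans (polar_bound _ _) _; rewrite quad_real.
rewrite ler_pM2r ?invr_gt0 // lerD2r ler_piMl ?(quad_ge0 hQ) //.
by rewrite exprn_ile1.
Qed.

Lemma polarZr (t : R) x y : polar Q x (toC t *: y) = t * polar Q x y.
Proof. by rewrite polarC polarZl polarC. Qed.

Lemma polar_scale k x y : polar Q (k *: x) (k *: y) = sqmod k * polar Q x y.
Proof. by rewrite /polar -scalerDr -scalerBr !(quadZ hQ); ring. Qed.

(** Multiplication by [i] preserves the real form, hence is antisymmetric for it; this makes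
[polar Q x y + i polar Q x (i y)] sesquilinear. *)
Lemma polar_i x y : polar Q ('i%C *: x) y = - polar Q x ('i%C *: y).
Proof.
have e : 'i%C *: ('i%C *: x) = - x by rewrite scalerA -expr2 sqr_i scaleN1r.
by have := polar_scale 'i%C ('i%C *: x) y; rewrite e sqmod_i mul1r polarNl.
Qed.

Lemma quadD x y : Q (x + y) = Q x + 2 * polar Q x y + Q y.
Proof. by have := quad_parallelogram hQ x y; rewrite /polar => h; lra. Qed.

Lemma polar_CS x y : polar Q x y ^+ 2 <= Q x * Q y.
Proof.
have h t : 0 <= Q x - 2 * t * polar Q x y + t ^+ 2 * Q y.
  have := quad_ge0 hQ (x + toC (- t) *: y).
  by rewrite quadD polarZr quad_real sqrrN => h; lra.
have [y0|yn0] := eqVneq (Q y) 0.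
  rewrite y0 mulr0; have [->|pn0] := eqVneq (polar Q x y) 0; first by rewrite expr0n.
  have := h ((Q x + 1) / (2 * polar Q x y)); rewrite y0 mulr0 addr0.
  have -> : Q x - 2 * ((Q x + 1) / (2 * polar Q x y)) * polar Q x y = -1.
    by field.
  by rewrite lerNr oppr0 ler10.
have y0 : 0 < Q y by rewrite lt_neqAle eq_sym yn0 (quad_ge0 hQ).
have := h (polar Q x y / Q y).
have -> : Q x - 2 * (polar Q x y / Q y) * polar Q x y + (polar Q x y / Q y) ^+ 2 * Q y
   = (Q x * Q y - polar Q x y ^+ 2) / Q y by field.
by rewrite pmulr_lge0 ?invr_gt0 // subr_ge0.
Qed.

Lemma quad_triangle x y : Num.sqrt (Q (x + y)) <= Num.sqrt (Q x) + Num.sqrt (Q y).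
Proof.
rewrite -[leRHS]ger0_norm ?addr_ge0 ?sqrtr_ge0 // -sqrtr_sqr ler_wsqrtr //.
rewrite sqrrD !sqr_sqrtr ?(quad_ge0 hQ) // quadD lerD2r lerD2l -[leRHS]mulr_natl.
rewrite ler_pM2l // -sqrtrM ?(quad_ge0 hQ) //.
apply: le_trans (ler_norm _) _; rewrite -sqrtr_sqr ler_wsqrtr //; exact: polar_CS.
Qed.

End Polar.

End QuadraticForms.

(** * The Hilbert space of bounded functionals *)

Structure quadForm (R : realType) (V : lmodType R[i]) := QuadForm {
  qform :> V -> R ;
  qformP : quadratic qform }.

Section Dual.
Variables (R : realType) (V : lmodType R[i]) (Q : quadForm V).
Local Notation toC := (real_complex R).
Let hQ := qformP Q.

(** Functionals are real valued: the completeness of [R] suffices for them, and complex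
scalars act on the argument, without conjugation. *)
Record dual_functional (f : V -> R) : Prop := {
  dual_funD : forall x y, f (x + y) = f x + f y ;
  dual_funZ : forall (t : R) x, f (toC t *: x) = t * f x ;
  dual_fun_bounded : exists M, forall x, f x ^+ 2 <= M * Q x }.

Definition dual_pred : {pred V -> R} := fun f => `[< dual_functional f >].

Lemma dual_functional_lin (s : R) f g : dual_functional f -> dual_functional g ->
  dual_functional (fun x => f x + s * g x).
Proof.
move=> [fD fZ [M fM]] [gD gZ [N gN]]; split.
- by move=> x y; rewrite fD gD; ring.
- by move=> t x; rewrite fZ gZ; ring.
exists (2 * (M + s ^+ 2 * N)) => x.
have h1 := fM x; have : s ^+ 2 * g x ^+ 2 <= s ^+ 2 * (N * Q x).
  by rewrite ler_wpM2l ?sqr_ge0.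
have := sqr_ge0 (f x - s * g x); rewrite sqrrB sqrrD exprMn => h2 h3.
apply: (@le_trans _ _ (2 * (f x ^+ 2 + s ^+ 2 * g x ^+ 2))); first by lra.
have -> : 2 * (M + s ^+ 2 * N) * Q x = 2 * (M * Q x + s ^+ 2 * (N * Q x)) by ring.
by lra.
Qed.

Lemma dual_zmod_closed : zmod_closed dual_pred.
Proof.
split=> [|f g /asboolP hf /asboolP hg]; apply/asboolP.
  by split=> [x y|t x|]; rewrite ?addr0 ?mulr0 //; exists 0 => x; rewrite expr0n mul0r.
have := dual_functional_lin (-1) hf hg; congr dual_functional.
by apply/funext => x; rewrite mulN1r.
Qed.

HB.instance Definition _ := GRing.isZmodClosed.Build (V -> R) dual_pred dual_zmod_closed.

Record dual := Dual { dual_fun :> V -> R; _ : dual_fun \in dual_pred }.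

HB.instance Definition _ := [isSub for dual_fun].
HB.instance Definition _ := [Choice of dual by <:].
HB.instance Definition _ := [SubChoice_isSubZmodule of dual by <:].

Definition mkDual (f : V -> R) (hf : dual_functional f) : dual := Dual (asboolT hf).

Lemma dualP (f : dual) : dual_functional f.
Proof. by case: f => f /= /asboolP. Qed.

Lemma dual_eq (f g : dual) : (forall x, f x = g x) -> f = g.
Proof. by move=> h; apply: val_inj; apply/funext. Qed.

Lemma dual_addE (f g : dual) x : (f + g) x = f x + g x. Proof. by []. Qed.

Lemma dual_scale_subproof (k : R[i]) (f : dual) : dual_functional (fun x => f (k *: x)).
Proof.
have [fD fZ [M fM]] := dualP f; split.
- by move=> x y; rewrite scalerDr fD.
- by move=> t x; rewrite scalerA mulrC -scalerA fZ.
by exists (M * sqmod k) => x; rewrite -mulrA -(quadZ hQ).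
Qed.

Definition dual_scale (k : R[i]) (f : dual) : dual := mkDual (dual_scale_subproof k f).

Lemma dual_scaleA k l f : dual_scale k (dual_scale l f) = dual_scale (k * l) f.
Proof. by apply: dual_eq => x /=; rewrite scalerA mulrC. Qed.
Lemma dual_scale1 : left_id 1 dual_scale.
Proof. by move=> f; apply: dual_eq => x /=; rewrite scale1r. Qed.
Lemma dual_scaleDr : right_distributive dual_scale +%R.
Proof. by move=> k f g; apply: dual_eq. Qed.
Lemma dual_scaleDl f : {morph dual_scale^~ f : k l / k + l}.
Proof.
by move=> k l; apply: dual_eq => x; rewrite dual_addE /= scalerDl (dual_funD (dualP f)).
Qed.

HB.instance Definition _ := GRing.Zmodule_isLmodule.Build R[i] dual
  dual_scaleA dual_scale1 dual_scaleDr dual_scaleDl.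

Lemma dual_scaleE (k : R[i]) (f : dual) x : (k *: f) x = f (k *: x). Proof. by []. Qed.

Definition dual_sqnorm (f : dual) : R := sup [set f x ^+ 2 | x in [set x | Q x <= 1]].

Lemma dual_has_sup (f : dual) : has_sup [set f x ^+ 2 | x in [set x | Q x <= 1]].
Proof.
split; first by exists (f 0 ^+ 2); exists 0 => //=; rewrite (quad0 hQ) ler01.
have [_ _ [M fM]] := dualP f; exists `|M| => _ [x /= x1 <-].
apply: le_trans (fM x) _; apply: le_trans (ler_norm _) _.
by rewrite normrM ler_piMr // ger0_norm // (quad_ge0 hQ).
Qed.

Lemma dual_sqnorm_ge0 f : 0 <= dual_sqnorm f.
Proof.
apply: (@le_trans _ _ (f 0 ^+ 2)); first exact: sqr_ge0.
apply: ub_le_sup; first by have [] := dual_has_sup f.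
by exists 0 => //=; rewrite (quad0 hQ) ler01.
Qed.

Lemma dual_sqnorm_bound (f : dual) x : f x ^+ 2 <= dual_sqnorm f * Q x.
Proof.
have [x0|xn0] := eqVneq (Q x) 0.
  have [_ _ [M fM]] := dualP f.
  by have := fM x; rewrite x0 !mulr0.
have q0 : 0 < Q x by rewrite lt_neqAle eq_sym xn0 (quad_ge0 hQ).
have s0 : Num.sqrt (Q x) != 0 by rewrite gt_eqF // sqrtr_gt0.
rewrite -ler_pdivrMr //.
have -> : f x ^+ 2 / Q x = f (toC (Num.sqrt (Q x))^-1 *: x) ^+ 2.
  rewrite (dual_funZ (dualP f)) exprMn mulrC exprVn sqr_sqrtr //; exact: ltW.
apply: ub_le_sup; first by have [] := dual_has_sup f.
exists (toC (Num.sqrt (Q x))^-1 *: x) => //=.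
by rewrite (quad_real hQ) exprVn sqr_sqrtr ?mulVf // ltW.
Qed.

Lemma dual_sqnorm_le (f : dual) M : 0 <= M -> (forall x, f x ^+ 2 <= M * Q x) ->
  dual_sqnorm f <= M.
Proof.
move=> M0 h; apply: ge_sup => [|_ [x /= x1 <-]]; first by have [] := dual_has_sup f.
by apply: le_trans (h x) _; rewrite ler_piMr.
Qed.

Lemma dual_sqnormZ k f : dual_sqnorm (k *: f) = sqmod k * dual_sqnorm f.
Proof.
have le l g : dual_sqnorm (l *: g) <= sqmod l * dual_sqnorm g.
  apply: dual_sqnorm_le => [|x]; first by rewrite mulr_ge0 ?sqmod_ge0 ?dual_sqnorm_ge0.
  by rewrite dual_scaleE -mulrA mulrCA -(quadZ hQ) dual_sqnorm_bound.
apply/eqP; rewrite eq_le le /=.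
have [->|k0] := eqVneq k 0; first by rewrite (sqmod_real 0) expr0n mul0r dual_sqnorm_ge0.
have := le k^-1 (k *: f); rewrite scalerA mulVf // scale1r => h.
have := ler_wpM2l (sqmod_ge0 k) h.
by rewrite mulrA -sqmodM mulfV // (sqmod_real 1) expr1n mul1r.
Qed.

(** For [x] and [y] in the unit ball, evaluate [f + g] at [x] and [f - g] at [y] and scale
[x] and [y] by the values [a] and [b] found. Then [a^2 + b^2] equals
[f (v + w) + g (v - w)], which the Cauchy inequality and the parallelogram law for [Q]
bound by the square root of [2 N (a^2 + b^2)], where [N] is the sum of the two squared
norms. *)
Lemma dual_sqnorm_parallelogram_le f g :
  dual_sqnorm (f + g) + dual_sqnorm (f - g) <= 2 * (dual_sqnorm f + dual_sqnorm g).
Proof.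
set N := dual_sqnorm f + dual_sqnorm g.
have key x y : Q x <= 1 -> Q y <= 1 -> (f + g) x ^+ 2 + (f - g) y ^+ 2 <= 2 * N.
  move=> x1 y1; set a := (f + g) x; set b := (f - g) y.
  set v := toC a *: x; set w := toC b *: y.
  have e : a ^+ 2 + b ^+ 2 = f (v + w) + g (v - w).
    rewrite !(dual_funD (dualP _)) -[- w]scaleN1r -(rmorphN1 toC) /= !(dual_funZ (dualP _)).
    transitivity (a * (f x + g x) + b * (f y - g y)); first by rewrite !expr2.
    by ring.
  have h1 := dual_sqnorm_bound f (v + w); have h2 := dual_sqnorm_bound g (v - w).
  have h3 : (f (v + w) + g (v - w)) ^+ 2 <= N * (Q (v + w) + Q (v - w)).
    have f0 := dual_sqnorm_ge0 f; have g0 := dual_sqnorm_ge0 g.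
    have p0 := quad_ge0 hQ (v + w); have q0 := quad_ge0 hQ (v - w).
    rewrite /N; move: h1 h2 f0 g0 p0 q0.
    move: (f _) (g _) (dual_sqnorm f) (dual_sqnorm g) (Q _) (Q _) => p q F G P' P.
    move=> h1 h2 F0 G0 P0 Q0.
    have h : 2 * p * q <= F * P' + G * P.
      apply: le_trans (ler_norm _) _.
      rewrite -ler_sqr ?nnegrE ?addr_ge0 ?mulr_ge0 // real_normK ?num_real //.
      have : p ^+ 2 * q ^+ 2 <= (F * P) * (G * P').
        by apply: ler_pM; rewrite ?sqr_ge0.
      have := sqr_ge0 (F * P' - G * P).
      by rewrite sqrrB sqrrD !exprMn => *; lra.
    by rewrite sqrrD -mulr_natl; lra.
  rewrite (quad_parallelogram hQ) -e in h3.
  have h4 : Q v + Q w <= a ^+ 2 + b ^+ 2.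
    by rewrite /v /w !(quad_real hQ) lerD // ler_piMr // sqr_ge0.
  have N0 : 0 <= N by rewrite addr_ge0 ?dual_sqnorm_ge0.
  have [->|n0] := eqVneq (a ^+ 2 + b ^+ 2) 0; first by rewrite mulr_ge0.
  have p0 : 0 < a ^+ 2 + b ^+ 2 by rewrite lt_neqAle eq_sym n0 addr_ge0 ?sqr_ge0.
  rewrite -(ler_pM2l p0) -expr2; apply: le_trans h3 _.
  have -> : N * (2 * (Q v + Q w)) = (Q v + Q w) * (2 * N) by ring.
  by rewrite ler_wpM2r ?mulr_ge0.
rewrite -lerBrDr; apply: ge_sup => [|_ [x /= x1 <-]]; first by have [] := dual_has_sup (f + g).
rewrite lerBrDr addrC -lerBrDr; apply: ge_sup => [|_ [y /= y1 <-]].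
  by have [] := dual_has_sup (f - g).
by rewrite lerBrDr addrC key.
Qed.

(** The reverse inequality is the same inequality for [f + g] and [f - g]. *)
Lemma dual_sqnorm_quadratic : quadratic dual_sqnorm.
Proof.
split=> [|f g|]; [exact: dual_sqnorm_ge0| |exact: dual_sqnormZ].
apply/eqP; rewrite eq_le dual_sqnorm_parallelogram_le /=.
have := dual_sqnorm_parallelogram_le (f + g) (f - g).
have dbl h : dual_sqnorm (h + h) = 4 * dual_sqnorm h.
  rewrite -[h in LHS]scale1r -scalerDl dual_sqnormZ.
  have -> : (1 + 1 : R[i]) = toC 2 by rewrite (rmorph_nat toC).
  by rewrite sqmod_real; ring.
rewrite addrACA subrr addr0 opprB [f + g + (g - f)]addrACA [g - f]addrC.
by rewrite addrACA subrr add0r !dbl => h; lra.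
Qed.

Definition dual_form : quadForm dual := QuadForm dual_sqnorm_quadratic.

Lemma dual_sqnorm_eq0 f : dual_sqnorm f = 0 -> f = 0.
Proof.
move=> h; apply: dual_eq => x; have := dual_sqnorm_bound f x.
by rewrite h mul0r exprn_even_le0 //= => /eqP.
Qed.

End Dual.

Section DualHilbert.
Variables (R : realType) (V : lmodType R[i]) (Q : quadForm V).
Local Notation toC := (real_complex R).
Local Notation D := (@dual_sqnorm R V Q).
Let hD := dual_sqnorm_quadratic Q.

Definition dual_norm (f : dual Q) : R[i] := toC (Num.sqrt (D f)).

Lemma dual_normD f g : dual_norm (f + g) <= dual_norm f + dual_norm g.
Proof. by rewrite /dual_norm -rmorphD /= lecR quad_triangle. Qed.

Lemma dual_normZ (k : R[i]) f : dual_norm (k *: f) = `|k| * dual_norm f.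
Proof.
rewrite /dual_norm dual_sqnormZ sqrtrM ?sqmod_ge0 // rmorphM /=; congr (_ * _).
by rewrite /sqmod -add_Re2_Im2 /= normc_def.
Qed.

Lemma dual_norm_eq0 f : dual_norm f = 0 -> f = 0.
Proof.
move=> /(congr1 (@complex.Re R)) /= /eqP; rewrite sqrtr_eq0 => h.
by apply: dual_sqnorm_eq0; apply/eqP; rewrite eq_le h dual_sqnorm_ge0.
Qed.

HB.instance Definition _ := Lmodule_isNormed.Build R[i] (dual Q)
  dual_normD dual_normZ dual_norm_eq0.

Lemma dual_normE (f : dual Q) : `|f| = toC (Num.sqrt (D f)). Proof. by []. Qed.

Lemma dual_norm_lt (f : dual Q) (e : R) : 0 < e -> `|f| < toC e -> D f <= e ^+ 2.
Proof.
move=> e0; rewrite dual_normE ltcR => h.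
by rewrite -[leLHS]sqr_sqrtr ?dual_sqnorm_ge0 // lerXn2r ?nnegrE ?sqrtr_ge0 ?ltW.
Qed.

(** A Cauchy filter converges pointwise, at a rate which is uniform on the unit ball; so its
pointwise limit is bounded and is its limit in norm. *)
Lemma dual_complete (F : set_system (dual Q)) : ProperFilter F -> cauchy F -> cvg F.
Proof.
move=> FF Fc.
have Fball (e : R) : 0 < e -> exists2 A, F A & forall f g, A f -> A g -> D (f - g) <= e ^+ 2.
  move=> e0; have e2 : 0 < toC (e / 2) by rewrite (ltcR 0) divr_gt0.
  have [f0 Af0] := (cauchyP F).1 Fc _ e2.
  exists (ball f0 (toC (e / 2))) => // f g.
  rewrite -!ball_normE /= => hf hg; apply: dual_norm_lt => //.
  have -> : toC e = toC (e / 2) + toC (e / 2) by rewrite -rmorphD /= -splitr.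
  have -> : f - g = - (f0 - f) + (f0 - g) by rewrite opprB addrA subrK.
  by apply: le_lt_trans (ler_normD _ _) _; rewrite normrN ltrD.
have ptc x : cvg ((fun f : dual Q => f x) @ F).
  apply: R_complete; apply: cauchy_exP => e e0.
  have q0 : 0 < 1 + Q x by rewrite ltr_pwDl ?(quad_ge0 (qformP Q)).
  have [A FA hA] := Fball _ (divr_gt0 e0 q0).
  have [f0 Af0] := filter_ex FA; exists (f0 x).
  change (F [set f : dual Q | ball (f0 x) e (f x)]); apply: filterS FA => f Af; rewrite /ball /=.
  rewrite -(@ltr_pXn2r _ 2) ?nnegrE ?(ltW e0) ?normr_ge0 //.
  rewrite real_normK ?num_real //.
  apply: le_lt_trans (dual_sqnorm_bound (f0 - f) x) _.
  apply: le_lt_trans (ler_wpM2r (quad_ge0 (qformP Q) x) (hA _ _ Af0 Af)) _.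
  rewrite exprMn -mulrA gtr_pMr ?exprn_gt0 // exprVn mulrC ltr_pdivrMr ?exprn_gt0 // mul1r.
  by have := quad_ge0 (qformP Q) x; rewrite sqrrD; move: (Q x) => q; nra.
pose g x := lim ((fun f : dual Q => f x) @ F).
have gc x : (fun f : dual Q => f x) @ F --> g x by exact: ptc.
have gD x y : g (x + y) = g x + g y.
  apply: (cvg_unique _ (gc (x + y))); first exact: Rhausdorff.
  have -> : (fun f : dual Q => f (x + y)) = (fun f : dual Q => f x) \+ (fun f : dual Q => f y).
    by apply/funext => f /=; rewrite (dual_funD (dualP f)).
  exact: cvgD.
have gZ (t : R) x : g (toC t *: x) = t * g x.
  apply: (cvg_unique _ (gc (toC t *: x))); first exact: Rhausdorff.
  have -> : (fun f : dual Q => f (toC t *: x)) = (fun f : dual Q => t * f x).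
    by apply/funext => f /=; rewrite (dual_funZ (dualP f)).
  by apply: cvgM => //; exact: cvg_cst.
have near_g (e : R) : 0 < e ->
    exists2 A, F A & forall f x, A f -> (f x - g x) ^+ 2 <= e ^+ 2 * Q x.
  move=> e0; have [A FA hA] := Fball e e0; exists A => // f x Af.
  have Q0 := quad_ge0 (qformP Q) x.
  suff : `|f x - g x| <= e * Num.sqrt (Q x).
    move=> h; rewrite -[leLHS]real_normK ?num_real // -[Q x]sqr_sqrtr // -exprMn.
    by rewrite lerXn2r ?nnegrE ?mulr_ge0 ?sqrtr_ge0 // ltW.
  apply/ler_addgt0Pr => eta eta0.
  have Fe : F [set f1 : dual Q | `|g x - f1 x| < eta].
    by have /cvgrPdist_lt /(_ _ eta0) := gc x.
  have [f1 [Af1 /= hf1]] := filter_ex (filterI FA Fe).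
  have -> : f x - g x = (f x - f1 x) - (g x - f1 x) by rewrite opprB addrA subrK.
  apply: le_trans (ler_normB _ _) _; rewrite lerD ?(ltW hf1) //.
  rewrite -(@ler_pXn2r _ 2) ?nnegrE ?mulr_ge0 ?sqrtr_ge0 ?normr_ge0 ?(ltW e0) //.
  rewrite real_normK ?num_real // exprMn sqr_sqrtr //.
  apply: le_trans (dual_sqnorm_bound (f - f1) x) _.
  by rewrite ler_wpM2r // hA.
have gB : exists M, forall x, g x ^+ 2 <= M * Q x.
  have [A FA hA] := near_g 1 ltr01; have [f Af] := filter_ex FA.
  exists (2 * D f + 2) => x.
  have := hA f x Af; have := dual_sqnorm_bound f x; have := sqr_ge0 (2 * f x - g x).
  rewrite expr1n mul1r [in X in _ -> _ -> _ -> X]mulrDl -mulrA.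
  by move: (f x) (g x) (D f * Q x) (Q x) => a b c q; nra.
have hG : dual_functional Q g by split.
pose G : dual Q := mkDual hG.
apply/cvg_ex; exists G; apply/cvgrPdist_lt => e e0.
have eR : toC (complex.Re e) = e by rewrite RRe_real // gtr0_real.
have r0 : 0 < complex.Re e by rewrite -ltcR eR.
have [A FA hA] := near_g _ (divr_gt0 r0 (ltr0n _ 2)).
apply: filterS FA => f Af.
rewrite -eR distrC dual_normE ltcR; apply: (@le_lt_trans _ _ (complex.Re e / 2)).
  have r2 : 0 <= complex.Re e / 2 by rewrite divr_ge0 // ltW.
  rewrite -[leRHS](ger0_norm r2) -sqrtr_sqr ler_wsqrtr //.
  apply: dual_sqnorm_le => [|x]; first exact: sqr_ge0.
  exact: hA.
by rewrite ltr_pdivrMr // ltr_pMr // ltr1n.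
Qed.

HB.instance Definition _ := Uniform_isComplete.Build (dual Q) dual_complete.

Definition dual_dot (f g : dual Q) : R[i] := Complex (polar D f g) (polar D f ('i%C *: g)).

Lemma dual_dotZl (k : R[i]) f g h : dual_dot (k *: f + g) h = k * dual_dot f h + dual_dot g h.
Proof.
rewrite /dual_dot !(polarDl hD); case: k => a b.
have -> : Complex a b *: f = toC a *: f + toC b *: ('i%C *: f).
  rewrite scalerA -scalerDl; congr (_ *: _); apply/eqP; rewrite eq_complex /=.
  by rewrite !mulr0 !mul0r !mulr1 subrr !addr0 add0r !eqxx.
rewrite !(polarDl hD) !(polarZl hD) !(polar_i hD) scalerA -expr2 sqr_i scaleN1r.
rewrite [polar D f (- h)](polarC hD) (polarNl hD) [polar D h f](polarC hD) opprK.
apply/eqP; rewrite eq_complex /=; apply/andP; split; apply/eqP; ring.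
Qed.

Lemma dual_dot_herm f g : dual_dot f g = (-1) ^+ false * (dual_dot g f)^*.
Proof.
rewrite expr0 mul1r /dual_dot; apply/eqP; rewrite eq_complex /=.
by rewrite [polar D g f](polarC hD) eqxx /= -(polar_i hD) [polar D _ f](polarC hD) eqxx.
Qed.

End DualHilbert.

Section DualHilbertInstance.
Variables (R : realType) (V : lmodType R[i]) (Q : quadForm V).
Local Notation toC := (real_complex R).

Lemma dual_dot_bilinear :
  bilinear_for ( *%R ) ((@Num.conj R[i]) \; *%R ) (@dual_dot R V Q).
Proof.
split=> h k f g /=; first exact: dual_dotZl.
rewrite dual_dot_herm expr0 mul1r dual_dotZl rmorphD rmorphM /=.
by rewrite [dual_dot h f]dual_dot_herm [dual_dot h g]dual_dot_herm !expr0 !mul1r.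
Qed.

HB.instance Definition _ := bilinear_isBilinear.Build R[i] (dual Q) (dual Q) R[i]
  ( *%R ) ((@Num.conj R[i]) \; *%R ) (@dual_dot R V Q) dual_dot_bilinear.

HB.instance Definition _ := isHermitianSesquilinear.Build R[i] (dual Q) false (@Num.conj R[i])
  (@dual_dot R V Q) (@dual_dot_herm R V Q).

Lemma dual_dotE (f : dual Q) : dual_dot f f = `|f| ^+ 2.
Proof.
have hD := dual_sqnorm_quadratic Q.
rewrite dual_normE -rmorphXn /= sqr_sqrtr ?dual_sqnorm_ge0 // /dual_dot (polarxx hD).
have := polar_i hD f f; rewrite (polarC hD) => h.
by have -> : polar (@dual_sqnorm R V Q) f ('i%C *: f) = 0 by lra.
Qed.

Lemma dual_dot_gt0 (f : dual Q) : f != 0 -> 0 < dual_dot f f.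
Proof. by move=> f0; rewrite dual_dotE exprn_gt0 // normr_gt0. Qed.

HB.instance Definition _ := isDotProduct.Build R[i] (dual Q) (@dual_dot R V Q) dual_dot_gt0.

HB.instance Definition _ := CompleteNormedModule_isHilbert.Build R (dual Q) dual_dotE.

Lemma hnorm_dual (f : dual Q) : hnorm f ^+ 2 = dual_sqnorm f.
Proof. by rewrite /hnorm dual_normE /= sqr_sqrtr // dual_sqnorm_ge0. Qed.

End DualHilbertInstance.

(** * Transposition and the bidual *)

Section BoundedMaps.
Variable R : realType.

Record bmap (V W : lmodType R[i]) (Q : quadForm V) (Q' : quadForm W) := BMap {
  bmap_fun :> V -> W ;
  bmap_linear : linear bmap_fun ;
  bmap_bounded : exists M, forall x, Q' (bmap_fun x) <= M * Q x }.

Section Transpose.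
Variables (V W : lmodType R[i]) (Q : quadForm V) (Q' : quadForm W).

Lemma bmapZ (T : bmap Q Q') k x : T (k *: x) = k *: T x.
Proof.
have Tl := bmap_linear T.
have T0 : T 0 = 0.
  by apply: (addrI (T 0)); have := Tl 1 0 0; rewrite !scale1r !addr0 => /esym.
by rewrite -[k *: x]addr0 Tl T0 addr0.
Qed.

Lemma transpose_subproof (T : bmap Q Q') (f : dual Q') :
  dual_functional Q (fun x => f (T x)).
Proof.
have [fD fZ _] := dualP f; have Tl := bmap_linear T; split.
- by move=> x y; rewrite -[x in LHS]scale1r Tl scale1r fD.
- by move=> t x; rewrite bmapZ fZ.
have [M TM] := bmap_bounded T; exists (dual_sqnorm f * M) => x.
apply: le_trans (dual_sqnorm_bound f (T x)) _; rewrite -mulrA ler_wpM2l //.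
exact: dual_sqnorm_ge0.
Qed.

Definition transpose_fun (T : bmap Q Q') (f : dual Q') : dual Q :=
  mkDual (transpose_subproof T f).

Lemma transpose_bound (T : bmap Q Q') M f : 0 <= M ->
  (forall x, Q' (T x) <= M * Q x) -> dual_sqnorm (transpose_fun T f) <= M * dual_sqnorm f.
Proof.
move=> M0 TM; apply: dual_sqnorm_le; first by rewrite mulr_ge0 ?dual_sqnorm_ge0.
move=> x; apply: le_trans (dual_sqnorm_bound f (T x)) _.
by rewrite [M * _]mulrC -mulrA ler_wpM2l // dual_sqnorm_ge0.
Qed.

Lemma transpose_linear (T : bmap Q Q') : linear (transpose_fun T).
Proof.
move=> k f g; apply: dual_eq => x.
change (f (k *: T x) + g (T x) = f (T (k *: x)) + g (T x)).
by rewrite bmapZ.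
Qed.

Lemma transpose_bounded (T : bmap Q Q') :
  exists M, forall f, dual_form Q (transpose_fun T f) <= M * dual_form Q' f.
Proof.
have [M TM] := bmap_bounded T; exists `|M| => f; apply: transpose_bound => // x.
apply: le_trans (TM x) _; rewrite ler_wpM2r ?ler_norm //.
exact: (quad_ge0 (qformP Q)).
Qed.

Definition transpose (T : bmap Q Q') : bmap (dual_form Q') (dual_form Q) :=
  BMap (transpose_linear T) (transpose_bounded T).
End Transpose.

Section Bidual.
Variables (V : lmodType R[i]) (Q : quadForm V).
Let hQ := qformP Q.

Definition bidual := dual (dual_form Q).

Lemma evaluation_subproof (v : V) : dual_functional (dual_form Q) (fun f : dual Q => f v).
Proof.
split=> [//|t f|]; first by rewrite dual_scaleE (dual_funZ (dualP f)).
by exists (Q v) => f; rewrite mulrC dual_sqnorm_bound.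
Qed.

(** The bidual serves as the Hilbert space completion of [(V, Q)]. *)
Definition evaluation (v : V) : bidual := mkDual (evaluation_subproof v).

Lemma evaluationP k v w : evaluation (k *: v + w) = k *: evaluation v + evaluation w.
Proof. by apply: dual_eq => f /=; rewrite (dual_funD (dualP f)). Qed.

Lemma polar_functional v : dual_functional Q (fun x => polar Q x v).
Proof.
split=> [x y|t x|]; [exact: (polarDl hQ)|exact: (polarZl hQ)|].
by exists (Q v) => x; rewrite mulrC (polar_CS hQ).
Qed.

(** The functional [polar Q ^~ v] attains the norm. *)
Lemma dual_sqnorm_evaluation v : dual_sqnorm (evaluation v) = Q v.
Proof.
have v0 := quad_ge0 hQ v; apply/eqP; rewrite eq_le; apply/andP; split.
  by apply: dual_sqnorm_le => // f /=; rewrite mulrC dual_sqnorm_bound.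
have [->|vn0] := eqVneq (Q v) 0; first exact: dual_sqnorm_ge0.
have vp : 0 < Q v by rewrite lt_neqAle eq_sym vn0.
pose fv := mkDual (polar_functional v).
have h : dual_sqnorm fv <= Q v.
  by apply: dual_sqnorm_le => // x /=; rewrite mulrC (polar_CS hQ).
have := dual_sqnorm_bound (evaluation v) fv; rewrite /= (polarxx hQ) => h2.
rewrite -(ler_pM2r vp) -expr2; apply: le_trans h2 _.
by rewrite ler_wpM2l // dual_sqnorm_ge0.
Qed.

Lemma hnorm_evaluation v : hnorm (evaluation v) ^+ 2 = Q v.
Proof. by rewrite hnorm_dual dual_sqnorm_evaluation. Qed.

Definition bitranspose (T : bmap Q Q) : bmap (dual_form (dual_form Q)) (dual_form (dual_form Q)) :=
  transpose (transpose T).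

Lemma bitranspose_evaluation (T : bmap Q Q) v :
  bitranspose T (evaluation v) = evaluation (T v).
Proof. exact: dual_eq. Qed.

Lemma bitranspose_bound (T : bmap Q Q) M (F : bidual) : 0 <= M ->
  (forall x, Q (T x) <= M * Q x) -> hnorm (bitranspose T F : bidual) ^+ 2 <= M * hnorm F ^+ 2.
Proof.
move=> M0 TM; rewrite !hnorm_dual; apply: transpose_bound => // f; exact: transpose_bound.
Qed.

End Bidual.

End BoundedMaps.

(** * Sums of squares of linear functionals *)

Lemma sum_funE (T : Type) (U : nmodType) (I : finType) (f : I -> T -> U) x :
  (\sum_i f i) x = \sum_i f i x.
Proof. by rewrite fct_sumE. Qed.

Section SumOfSquares.
Variables (R : realType) (V : lmodType R[i]).
Local Notation toC := (real_complex R).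

Definition functional := {phi : V -> R[i] | scalar phi}.

(** Positive finite rank Hermitian tensors are represented by the functions they induce on
linear functionals: [square v] stands for the tensor of [v] with its conjugate. *)
Definition square (v : V) : functional -> R^o := fun phi => sqmod (proj1_sig phi v).

Lemma functionalP (phi : functional) k u v :
  proj1_sig phi (k *: u + v) = k * proj1_sig phi u + proj1_sig phi v.
Proof. by case: phi => phi hphi; exact: hphi. Qed.

Lemma functionalD (phi : functional) u v :
  proj1_sig phi (u + v) = proj1_sig phi u + proj1_sig phi v.
Proof. by have := functionalP phi 1 u v; rewrite scale1r mul1r. Qed.

Lemma functional0 (phi : functional) : proj1_sig phi 0 = 0.
Proof. by apply: (addrI (proj1_sig phi 0)); rewrite -functionalD !addr0. Qed.

Lemma functionalZ (phi : functional) k u : proj1_sig phi (k *: u) = k * proj1_sig phi u.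
Proof. by rewrite -[k *: u]addr0 functionalP functional0 addr0. Qed.

Lemma squareZ k v phi : square (k *: v) phi = sqmod k * square v phi.
Proof. by rewrite /square functionalZ sqmodM. Qed.

Lemma square_real (t : R) v phi : square (toC t *: v) phi = t ^+ 2 * square v phi.
Proof. by rewrite squareZ sqmod_real. Qed.

Lemma sqmod_parallelogram (k l : R[i]) :
  sqmod (k + l) + sqmod (k - l) = 2 * (sqmod k + sqmod l).
Proof.
rewrite /sqmod -!add_Re2_Im2 /=; case: k => a b; case: l => a' b' /=; ring.
Qed.

Lemma square_parallelogram v w phi :
  square (v + w) phi + square (v - w) phi = 2 * (square v phi + square w phi).
Proof.
rewrite /square -[- w]scaleN1r !functionalD functionalZ mulN1r; exact: sqmod_parallelogram.
Qed.

Variables (c : R) (G : V -> V -> Prop).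
Hypothesis GZ : forall (t : R) b b', G b b' -> G (toC t *: b) (toC t *: b').

(** The elements that an admissible form must make nonnegative: [G b b'] imposes
[Q b' <= c ^+ 2 * Q b], and all [square w] are nonnegative. The representation by
explicit finite families is what the factorization uses. *)
Definition sos_cone : set (functional -> R^o) := [set g |
  exists (K L : finType) (b b' : K -> V) (w : L -> V), (forall k, G (b k) (b' k)) /\
  forall phi, g phi = \sum_k (c ^+ 2 * square (b k) phi - square (b' k) phi)
                      + \sum_l square (w l) phi].

Lemma sos_cone_convex : convex_cone sos_cone.
Proof.
split=> [g h [K [L [b [b' [w [hG hg]]]]]] [K' [L' [d [d' [x [hG' hh]]]]]]
        |t g t0 [K [L [b [b' [w [hG hg]]]]]]].
  exists (K + K')%type, (L + L')%type.
  exists (fun s => match s with inl k => b k | inr k => d k end).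
  exists (fun s => match s with inl k => b' k | inr k => d' k end).
  exists (fun s => match s with inl k => w k | inr k => x k end).
  split=> [[k|k] //|phi].
  by rewrite !big_sumType /= -[LHS]/(g phi + h phi) hg hh addrACA.
exists K, L, (fun k => toC (Num.sqrt t) *: b k), (fun k => toC (Num.sqrt t) *: b' k).
exists (fun l => toC (Num.sqrt t) *: w l); split=> [k|phi]; first exact: GZ.
rewrite -[LHS]/(t * g phi) hg mulrDr !mulr_sumr; congr (_ + _); apply: eq_bigr => k _.
  by rewrite !square_real sqr_sqrtr //; ring.
by rewrite square_real sqr_sqrtr.
Qed.

Lemma sos_square v : sos_cone (square v).
Proof.
exists void, unit, (fun x : void => match x with end).
exists (fun x : void => match x with end), (fun=> v).
split=> [[]|phi]; rewrite [X in X + _]big1 ?add0r => [|[] //].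
by rewrite (bigD1 tt) //= big1 ?addr0 // => -[].
Qed.

Lemma sos_generator b b' : G b b' -> sos_cone (c ^+ 2 *: square b - square b').
Proof.
move=> hG; exists unit, void, (fun=> b), (fun=> b'), (fun x : void => match x with end).
split=> [//|phi]; rewrite [X in _ = _ + X]big1 ?addr0 => [|[] //].
by rewrite (bigD1 tt) //= big1 ?addr0 // => -[].
Qed.

Variables (J : finType) (e : J -> V).
Definition unit_sos : functional -> R^o := \sum_j square (e j).

Lemma sos_sum (I : finType) (v : I -> V) (P : pred I) : sos_cone (\sum_(i | P i) square (v i)).
Proof.
have cP := sos_cone_convex; apply: (big_ind sos_cone).
- rewrite -(scale0r (square 0)); apply: (cone_scale cP) => //; exact: sos_square.
- exact: (cone_add cP).
by move=> i _; exact: sos_square.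
Qed.

(** These are the vectors at which the separating functional is under control: the unit of
the cone dominates their square. *)
Definition sos_dominated (v : V) :=
  exists2 t : R, 0 <= t & sos_cone (t *: unit_sos - square v).

Lemma sos_dominated_bounded v : sos_dominated v ->
  order_bounded sos_cone unit_sos (square v).
Proof.
move=> [t t0 ht]; exists t; split=> //; have cP := sos_cone_convex.
apply: (cone_add cP); last exact: sos_square.
by apply: (cone_scale cP) => //; exact: sos_sum.
Qed.

Lemma sos_dominatedD v w : sos_dominated v -> sos_dominated w -> sos_dominated (v + w).
Proof.
have cP := sos_cone_convex; move=> [t t0 ht] [s s0 hs].
exists (2 * (t + s)); first by rewrite mulr_ge0 // addr_ge0.
have -> : (2 * (t + s)) *: unit_sos - square (v + w) =
    (2 : R) *: ((t *: unit_sos - square v) + (s *: unit_sos - square w)) + square (v - w).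
  apply/funext => phi; have := square_parallelogram v w phi.
  rewrite !fctE /GRing.scale /= => h; lra.
apply: (cone_add cP); last exact: sos_square.
by apply: (cone_scale cP) => //; exact: (cone_add cP).
Qed.

Lemma sos_dominated_generator (M : R) j b' : 0 <= M -> G (e j) b' ->
  sos_dominated (toC M *: b').
Proof.
have cP := sos_cone_convex; move=> M0 hG; exists (M ^+ 2 * c ^+ 2).
  by rewrite mulr_ge0 ?sqr_ge0.
have -> : (M ^+ 2 * c ^+ 2) *: unit_sos - square (toC M *: b') =
   (M ^+ 2) *: (c ^+ 2 *: square (e j) - square b') +
   (M ^+ 2 * c ^+ 2) *: \sum_(i | i != j) square (e i).
  rewrite /unit_sos (bigD1 j) //=; apply/funext => phi.
  move: (\sum_(_ | _) _) => S.
  rewrite !fctE square_real /GRing.scale /=; ring.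
apply: (cone_add cP); apply: (cone_scale cP); rewrite -?exprMn ?sqr_ge0 //.
  exact: sos_generator.
exact: sos_sum.
Qed.

Record quadratic_on (S : set V) (Q : V -> R) : Prop := {
  quadon_ge0 : forall v, S v -> 0 <= Q v ;
  quadon_parallelogram : forall v w, S v -> S w -> Q (v + w) + Q (v - w) = 2 * (Q v + Q w) ;
  quadon_scale : forall k v, S v -> Q (k *: v) = sqmod k * Q v }.

(** A functional [L] that is nonnegative on the cone gives the form [L (square v)], which
inherits homogeneity and the parallelogram law from [square]. *)
Lemma quadratic_separation (S : set V) (I : finType) (x : I -> V) (lam : R) :
  (forall k v w, S v -> S w -> S (k *: v + w)) ->
  (forall v, S v -> sos_dominated v) ->
  (forall b b', G b b' -> S b /\ S b') ->
  (forall j, S (e j)) -> (forall i, S (x i)) ->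
  ~ sos_cone (lam *: unit_sos - \sum_i square (x i)) ->
  exists Q : V -> R,
    [/\ quadratic_on S Q, forall b b', G b b' -> Q b' <= c ^+ 2 * Q b,
        \sum_j Q (e j) = 1 & lam <= \sum_i Q (x i)].
Proof.
move=> Slin Sdom GS Se Sx nP; have cP := sos_cone_convex.
have bS v : S v -> order_bounded sos_cone unit_sos (square v).
  by move=> /Sdom /sos_dominated_bounded.
have S0 v : S v -> S 0 by move=> Sv; have := Slin (-1) v v Sv Sv; rewrite scaleN1r addNr.
have bD y z : order_bounded sos_cone unit_sos y -> order_bounded sos_cone unit_sos z ->
    order_bounded sos_cone unit_sos (y + z) by exact: order_boundedD.
have bZ k y : order_bounded sos_cone unit_sos y -> order_bounded sos_cone unit_sos (k *: y).
  exact: order_boundedZ.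
have b0 : order_bounded sos_cone unit_sos 0.
  exists 0; rewrite scale0r subrr addr0 -(scale0r (square 0)).
  by split; apply: (cone_scale cP) => //; exact: sos_square.
have bsum (T : finType) (v : T -> V) : (forall i, S (v i)) ->
    order_bounded sos_cone unit_sos (\sum_i square (v i)).
  move=> Sv; apply: (big_ind (order_bounded sos_cone unit_sos)) => // i _; exact: bS.
have bx : order_bounded sos_cone unit_sos (lam *: unit_sos - \sum_i square (x i)).
  apply: (bD); first exact/bZ/bsum.
  by apply: order_boundedN; exact: bsum.
have [L [LD LZ Lge0 L1 Lx]] := cone_separation cP (sos_sum e predT) bx nP.
have LN y : order_bounded sos_cone unit_sos y -> L (- y) = - L y.
  by move=> hy; rewrite -scaleN1r LZ // mulN1r.
have L0 : L 0 = 0 by rewrite -(scale0r (0 : functional -> R^o)) LZ // mul0r.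
have Lsum (T : finType) (v : T -> V) : (forall i, S (v i)) ->
    L (\sum_i square (v i)) = \sum_i L (square (v i)).
  move=> Sv; pose K (y : functional -> R^o) (l : R) :=
    order_bounded sos_cone unit_sos y /\ L y = l.
  suff : K (\sum_i square (v i)) (\sum_i L (square (v i))) by case.
  apply: (big_ind2 K) => [//|y1 l1 y2 l2 [h1 <-] [h2 <-]|i _]; last by split=> //; exact: bS.
  by split; [exact: bD|exact: LD].
have SD v w : S v -> S w -> S (v + w) by move=> Sv; rewrite -[v in S (v + w)]scale1r; exact: Slin.
have SZ k v : S v -> S (k *: v).
  by move=> Sv; rewrite -[_ *: _]addr0; apply: Slin => //; exact: S0 Sv.
have SN v : S v -> S (- v) by move=> Sv; rewrite -scaleN1r; exact: SZ.
exists (fun v => L (square v)); split.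
- split=> [v Sv|v w Sv Sw|k v Sv].
  + by apply: Lge0; [exact: bS|exact: sos_square].
  + rewrite -LD; [|by apply/bS/SD|by apply/bS/SD => //; exact: SN].
    have -> : square (v + w) + square (v - w) = (2 : R) *: (square v + square w).
      by apply/funext => phi; exact: square_parallelogram.
    rewrite LZ; last by apply: bD; exact: bS.
    by rewrite LD //; exact: bS.
  + have -> : square (k *: v) = sqmod k *: square v.
      by apply/funext => phi; exact: squareZ.
    by rewrite LZ //; exact: bS.
- move=> b b' hG; have [Sb Sb'] := GS _ _ hG.
  rewrite -subr_ge0 -LZ; last exact: bS.
  rewrite -LN; last exact: bS.
  have b1 : order_bounded sos_cone unit_sos (c ^+ 2 *: square b) by apply/bZ/bS.
  have b2 : order_bounded sos_cone unit_sos (- square b') by apply/order_boundedN/bS.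
  rewrite -LD //; apply: Lge0; first exact: bD.
  exact: sos_generator.
- by rewrite -Lsum.
- move: Lx; rewrite LD; [|exact/bZ/bsum|by apply/order_boundedN/bsum].
  rewrite LZ; last exact: bsum.
  by rewrite LN ?L1 ?mulr1 ?Lsum ?subr_le0 //; exact: bsum.
Qed.

Definition sum_family (T T' : Type) (f : T -> V) (g : T' -> V) (s : T + T') : V :=
  match s with inl i => f i | inr k => g k end.

(** Moving the negative squares to the other side, membership in the cone says that the
families [(x, c b, w)] and [(sqrt lam e, b')] have the same sum of squares. The rows of
the contraction that give [w] are then dropped. *)
Lemma sos_factorization (I : finType) (x : I -> V) (lam : R) : 0 <= lam ->
  (forall v : V, v != 0 -> exists2 phi, scalar phi & phi v != 0) ->
  sos_cone (lam *: unit_sos - \sum_i square (x i)) ->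
  exists (K : finType) (b b' : K -> V) (W : I + K -> J + K -> R[i]),
    [/\ forall k, G (b k) (b' k),
        forall i, sum_family x (fun k => toC c *: b k) i =
          \sum_j W i j *: sum_family (fun j => toC (Num.sqrt lam) *: e j) b' j
      & forall (H : hilbertType R) (h : J + K -> H),
          \sum_i hnorm (\sum_j W i j *: h j) ^+ 2 <= \sum_j hnorm (h j) ^+ 2].
Proof.
move=> lam0 sepV [K [L [b [b' [w [hG hg]]]]]].
pose y := sum_family (sum_family x (fun k => toC c *: b k)) w.
pose z := sum_family (fun j => toC (Num.sqrt lam) *: e j) b'.
have [phi hphi|W [hW contr]] := @gram_factorization R V _ _ y z sepV.
  have gE (T : finType) (v : T -> V) : gram v phi phi = toC (\sum_i sqmod (phi (v i))).
    by rewrite rmorph_sum; apply: eq_bigr => i _; rewrite /= sqmod_toC normCK.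
  rewrite !gE; congr (toC _).
  have := hg (exist _ phi hphi); rewrite !fctE /unit_sos !sum_funE /square /=.
  rewrite !big_sumType /= => h.
  have -> : \sum_i sqmod (phi (toC (Num.sqrt lam) *: e i)) = lam *: \sum_i sqmod (phi (e i)).
    rewrite scaler_sumr; apply: eq_bigr => i _.
    by have := square_real (Num.sqrt lam) (e i) (exist _ phi hphi); rewrite /square /= sqr_sqrtr.
  have -> : \sum_i sqmod (phi (toC c *: b i)) = \sum_i c ^+ 2 * sqmod (phi (b i)).
    apply: eq_bigr => i _.
    by have := square_real c (b i) (exist _ phi hphi); rewrite /square /=.
  move: h; rewrite [\sum_k (c ^+ 2 * _ - _)]sumrB /GRing.scale /= => h; lra.
exists K, b, b', (fun s => W (inl s)); split=> // [i|H h]; first exact: (hW (inl i)).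
apply: le_trans (contr H h); rewrite [leRHS]big_sumType /= lerDl.
by apply: sumr_ge0 => l _; exact: sqr_ge0.
Qed.

End SumOfSquares.

(** * Operator norms and evaluation of morphisms on rows *)

Section OperatorNorms.
Variables (R : realType) (H : hilbertType R).
Local Notation toC := (real_complex R).

Lemma hnormsq_real (t : R) (x : H) : hnorm (toC t *: x) ^+ 2 = t ^+ 2 * hnorm x ^+ 2.
Proof. by rewrite hnormsqZ sqmod_real. Qed.

Lemma hnormsq_eq0 (x : H) : hnorm x ^+ 2 = 0 -> x = 0.
Proof.
move=> /eqP; rewrite sqrf_eq0 => /eqP h.
by apply/eqP; rewrite -normr_eq0 -hnorm_toC h.
Qed.

Lemma hnorm0 : hnorm (0 : H) = 0.
Proof. by rewrite /hnorm normr0. Qed.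

Lemma linear_op0 (T : H -> H) : linear T -> T 0 = 0.
Proof.
by move=> Tl; apply: (addrI (T 0)); have := Tl 1 0 0; rewrite !scale1r !addr0 => /esym.
Qed.

Lemma linear_opZ (T : H -> H) : linear T -> forall k x, T (k *: x) = k *: T x.
Proof. by move=> Tl k x; rewrite -[k *: x]addr0 Tl linear_op0 // addr0. Qed.

Lemma opnorm_le (T : H -> H) (M : R) : 0 <= M ->
  (forall x, hnorm (T x) ^+ 2 <= M ^+ 2 * hnorm x ^+ 2) -> (opnorm T <= M%:E)%E.
Proof.
move=> M0 h; apply: ge_ereal_sup => _ [x /= x1 <-]; rewrite lee_fin.
rewrite -(@ler_pXn2r _ 2) ?nnegrE ?hnorm_ge0 //; apply: le_trans (h x) _.
by rewrite ler_piMr ?sqr_ge0 // exprn_ile1 // hnorm_ge0.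
Qed.

Lemma opnorm_bound (T : H -> H) (M : R) : linear T -> 0 <= M -> (opnorm T <= M%:E)%E ->
  forall x, hnorm (T x) ^+ 2 <= M ^+ 2 * hnorm x ^+ 2.
Proof.
move=> Tl M0 hT x; have [x0|xn0] := eqVneq (hnorm x) 0.
  have -> : x = 0 by apply: hnormsq_eq0; rewrite x0 expr0n.
  by rewrite linear_op0 // hnorm0 expr0n mulr0.
have xp : 0 < hnorm x by rewrite lt_neqAle eq_sym xn0 hnorm_ge0.
have : ((hnorm (T (toC (hnorm x)^-1 *: x)))%:E <= M%:E)%E.
  apply: le_trans hT; apply: ereal_sup_ubound; exists (toC (hnorm x)^-1 *: x) => //=.
  rewrite -(@ler_pXn2r _ 2) ?nnegrE ?hnorm_ge0 // hnormsq_real.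
  by rewrite -exprMn mulVf // expr1n.
rewrite lee_fin -(@ler_pXn2r _ 2) ?nnegrE ?hnorm_ge0 // linear_opZ // hnormsq_real exprVn.
by rewrite mulrC ler_pdivrMr // exprn_gt0.
Qed.

Lemma opnorm_finite (T : H -> H) : bounded_operator T ->
  exists2 M : R, 0 < M & (opnorm T <= M%:E)%E.
Proof.
move=> [_]; case: (opnorm T) => [r| |] // _.
  exists (`|r| + 1); first by rewrite ltr_wpDl.
  by rewrite lee_fin (le_trans (ler_norm r)) // lerDl.
by exists 1 => //; exact: leNye.
Qed.

Lemma mxopnorm_le n (a : 'M[H -> H]_n) (M : R) : 0 <= M ->
  (forall x, \sum_i hnorm (\sum_j a i j (x j)) ^+ 2 <= M ^+ 2 * \sum_j hnorm (x j) ^+ 2) ->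
  (mxopnorm a <= M%:E)%E.
Proof.
move=> M0 h; apply: ge_ereal_sup => _ [x /= x1 <-]; rewrite lee_fin.
rewrite -(ger0_norm M0) -sqrtr_sqr ler_wsqrtr //; apply: le_trans (h x) _.
by rewrite ler_piMr ?sqr_ge0.
Qed.

Lemma mxopnorm_bound n (a : 'M[H -> H]_n) (M : R) : (forall i j, linear (a i j)) ->
  0 <= M -> (mxopnorm a <= M%:E)%E ->
  forall x, \sum_i hnorm (\sum_j a i j (x j)) ^+ 2 <= M ^+ 2 * \sum_j hnorm (x j) ^+ 2.
Proof.
move=> al M0 ha x; set N := \sum_j hnorm (x j) ^+ 2.
have N0 : 0 <= N by apply: sumr_ge0 => j _; exact: sqr_ge0.
have [Nz|Nn0] := eqVneq N 0.
  have x0 j : x j = 0.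
    apply: hnormsq_eq0; apply/eqP; rewrite eq_le sqr_ge0 andbT -Nz /N (bigD1 j) //= lerDl.
    by apply: sumr_ge0 => i _; exact: sqr_ge0.
  rewrite Nz mulr0 big1 // => i _; rewrite big1 ?hnorm0 ?expr0n // => j _.
  by rewrite x0 linear_op0.
have Np : 0 < N by rewrite lt_neqAle eq_sym Nn0.
have s0 : Num.sqrt N != 0 by rewrite gt_eqF // sqrtr_gt0.
pose s := toC (Num.sqrt N)^-1.
have : ((Num.sqrt (\sum_i hnorm (\sum_j a i j (s *: x j)) ^+ 2))%:E <= M%:E)%E.
  apply: le_trans ha; apply: ereal_sup_ubound; exists (fun j => s *: x j) => //=.
  under eq_bigr => j _ do rewrite hnormsq_real.
  by rewrite -mulr_sumr exprVn sqr_sqrtr // mulVf.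
rewrite lee_fin => h.
have h2 : \sum_i hnorm (\sum_j a i j (s *: x j)) ^+ 2 <= M ^+ 2.
  rewrite -[leLHS]sqr_sqrtr; last by apply: sumr_ge0 => i _; exact: sqr_ge0.
  by rewrite ler_pXn2r ?nnegrE ?sqrtr_ge0.
have e : \sum_i hnorm (\sum_j a i j (s *: x j)) ^+ 2 =
    N^-1 * \sum_i hnorm (\sum_j a i j (x j)) ^+ 2.
  rewrite mulr_sumr; apply: eq_bigr => i _.
  under eq_bigr => j _ do rewrite linear_opZ //.
  by rewrite -scaler_sumr hnormsq_real exprVn sqr_sqrtr.
by rewrite e mulrC ler_pdivrMr in h2.
Qed.

End OperatorNorms.

Section MorphismEvaluation.
Variables (R : realType) (H0 : hilbertType R) (A : set (H0 -> H0)).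
Hypothesis hA : unital_operator_algebra A.
Local Notation toC := (real_complex R).
Local Notation op := (H0 -> H0).

Lemma opalg0 : A 0.
Proof.
have := opalg_lin hA (-1) (opalg_id hA) (opalg_id hA).
by rewrite scaleN1r addNr.
Qed.

Lemma opalgZ k a : A a -> A (k *: a).
Proof. by move=> Aa; rewrite -[k *: a]addr0; apply: (opalg_lin hA) => //; exact: opalg0. Qed.

Lemma opalgD a b : A a -> A b -> A (a + b).
Proof. by move=> Aa Ab; rewrite -[a]scale1r; exact: (opalg_lin hA). Qed.

Lemma opalgB a b : A a -> A b -> A (a - b).
Proof. by move=> Aa Ab; rewrite addrC -scaleN1r; exact: (opalg_lin hA). Qed.

Lemma opalg_sum (I : finType) (k : I -> R[i]) (a : I -> op) :
  (forall i, A (a i)) -> A (\sum_i k i *: a i).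
Proof.
by move=> Aa; apply: (big_ind A); [exact: opalg0|exact: opalgD|move=> i _; exact: opalgZ].
Qed.

Lemma morphism_inclusion : morphism A (H := H0) id.
Proof. by split=> // a Aa; exact: (opalg_bounded hA). Qed.

Section OneMorphism.
Variables (H : hilbertType R) (u : op -> H -> H).
Hypothesis hu : morphism A u.

Lemma morphism0 : u 0 = 0.
Proof.
have := morphism_lin hu (-1) (opalg_id hA) (opalg_id hA).
by rewrite !scaleN1r !addNr.
Qed.

Lemma morphismD a b : A a -> A b -> u (a + b) = u a + u b.
Proof. by move=> Aa Ab; have := morphism_lin hu 1 Aa Ab; rewrite !scale1r. Qed.

Lemma morphismZ k a : A a -> u (k *: a) = k *: u a.
Proof.
move=> Aa; have := morphism_lin hu k Aa opalg0.
by rewrite morphism0 !addr0.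
Qed.

Lemma morphism_sum (I : finType) (k : I -> R[i]) (a : I -> op) :
  (forall i, A (a i)) -> u (\sum_i k i *: a i) = \sum_i k i *: u (a i).
Proof.
move=> Aa.
suff : A (\sum_i k i *: a i) /\ u (\sum_i k i *: a i) = \sum_i k i *: u (a i) by case.
elim/big_rec2 : _ => [|i x y _ [Ax <-]]; first by split; [exact: opalg0|exact: morphism0].
have Ak := opalgZ (k i) (Aa i).
by split; [exact: opalgD|rewrite morphismD // morphismZ].
Qed.

Lemma morphism_linear a : A a -> linear (u a).
Proof. by move=> /(morphism_bounded_operator hu) []. Qed.

Lemma mnorm_bound (C : R) : 0 <= C -> (mnorm A u <= C%:E)%E ->
  forall a, A a -> (opnorm a <= 1)%E -> forall h, hnorm (u a h) ^+ 2 <= C ^+ 2 * hnorm h ^+ 2.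
Proof.
move=> C0 hC a Aa a1; apply: opnorm_bound => //; first exact: morphism_linear.
by apply: le_trans hC; apply: ereal_sup_ubound; exists a.
Qed.

(** The value at the vector [zeta] of the row operator with entries [u (v j)]. *)
Definition row_eval n (v : 'I_n -> op) (zeta : 'I_n -> H) : H := \sum_j u (v j) (zeta j).

Definition unit_row n (j : 'I_n) : 'I_n -> op := fun i => if i == j then idfun else 0.

Lemma row_eval_sum n (I : finType) (k : I -> R[i]) (v : I -> 'I_n -> op) zeta :
  (forall i j, A (v i j)) ->
  row_eval (\sum_i k i *: v i) zeta = \sum_i k i *: row_eval (v i) zeta.
Proof.
move=> Av; rewrite /row_eval.
under [RHS]eq_bigr => i _ do rewrite scaler_sumr.
rewrite exchange_big /=; apply: eq_bigr => j _.
have -> : (\sum_i k i *: v i) j = \sum_i k i *: v i j by rewrite sum_funE.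
by rewrite morphism_sum // sum_funE.
Qed.

Lemma row_evalZ n k (v : 'I_n -> op) zeta : (forall j, A (v j)) ->
  row_eval (k *: v) zeta = k *: row_eval v zeta.
Proof.
move=> Av; rewrite /row_eval scaler_sumr; apply: eq_bigr => j _.
by rewrite -[(k *: v) j]/(k *: v j) morphismZ.
Qed.

Lemma row_evalB n (v w : 'I_n -> op) zeta : (forall j, A (v j)) -> (forall j, A (w j)) ->
  row_eval (v - w) zeta = row_eval v zeta - row_eval w zeta.
Proof.
move=> Av Aw; rewrite /row_eval -sumrB; apply: eq_bigr => j _.
rewrite -[(v - w) j]/(v j - w j) -[- w j]scaleN1r morphismD //; last exact: opalgZ.
by rewrite morphismZ // scaleN1r.
Qed.

Lemma row_eval_comp n a (v : 'I_n -> op) zeta : A a -> (forall j, A (v j)) ->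
  row_eval (fun j => a \o v j) zeta = u a (row_eval v zeta).
Proof.
move=> Aa Av; have ul := morphism_linear Aa; rewrite /row_eval.
have uD x y : u a (x + y) = u a x + u a y by rewrite -[x in LHS]scale1r ul scale1r.
rewrite (big_morph _ uD (linear_op0 ul)); apply: eq_bigr => j _.
by rewrite (morphism_comp hu).
Qed.

Lemma row_eval_unit n (j : 'I_n) zeta : row_eval (unit_row j) zeta = zeta j.
Proof.
rewrite /row_eval (bigD1 j) //= /unit_row eqxx (morphism_id hu) big1 ?addr0 // => i ij.
by rewrite (negbTE ij) morphism0.
Qed.

End OneMorphism.

Lemma unit_row_in n (j i : 'I_n) : A (unit_row j i).
Proof. by rewrite /unit_row; case: eqP => _; [exact: (opalg_id hA)|exact: opalg0]. Qed.

(** Given the factorization [(x, c b) = W (sqrt lam e, a b)], the iterates of its lower half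
are [approx], and the upper half applied to them gives the truncations of [x]. *)
Section Truncation.
Variables (n : nat) (K : finType) (c lam : R) (W : 'I_n + K -> 'I_n + K -> R[i]).
Variables (a : K -> op) (b : K -> 'I_n -> op) (x : 'I_n -> 'I_n -> op).
Hypotheses (c1 : 1 < c) (lam0 : 0 <= lam).
Hypothesis Wcontr : forall (H : hilbertType R) (h : 'I_n + K -> H),
  \sum_i hnorm (\sum_j W i j *: h j) ^+ 2 <= \sum_j hnorm (h j) ^+ 2.
Hypotheses (Aa : forall k, A (a k)) (a1 : forall k, (opnorm (a k) <= 1)%E).
Hypotheses (Ab : forall k j, A (b k j)) (Ax : forall i j, A (x i j)).

Definition source (beta : K -> 'I_n -> op) : 'I_n + K -> 'I_n -> op :=
  sum_family (fun j => toC (Num.sqrt lam) *: unit_row j) (fun k j => a k \o beta k j).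

Definition transfer (beta : K -> 'I_n -> op) (s : 'I_n + K) : 'I_n -> op :=
  \sum_t W s t *: source beta t.

Hypothesis xb : forall s, sum_family x (fun k => toC c *: b k) s = transfer b s.

Definition feedback (beta : K -> 'I_n -> op) (k : K) : 'I_n -> op :=
  toC c^-1 *: transfer beta (inr k).

Definition approx (s : nat) : K -> 'I_n -> op := iter s feedback (fun _ => 0).

Lemma source_in beta : (forall k j, A (beta k j)) -> forall t j, A (source beta t j).
Proof.
move=> Abeta [i|k] j /=; last exact: (opalg_comp hA).
by apply: opalgZ; exact: unit_row_in.
Qed.

Lemma transfer_in beta : (forall k j, A (beta k j)) -> forall s j, A (transfer beta s j).
Proof.
move=> Abeta s j; rewrite /transfer sum_funE; apply: opalg_sum => t; exact: source_in.
Qed.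

Lemma approx_in s k j : A (approx s k j).
Proof.
elim: s k j => [|s ih] k j; first exact: opalg0.
by apply: opalgZ; exact: transfer_in.
Qed.

Section Estimates.
Variables (H : hilbertType R) (u : op -> H -> H) (C : R) (zeta : 'I_n -> H).
Hypotheses (hu : morphism A u) (C0 : 0 <= C) (uC : (mnorm A u <= C%:E)%E).
Local Notation ev v := (row_eval u v zeta).
Let N := \sum_j hnorm (zeta j) ^+ 2.
Definition family_energy (beta : K -> 'I_n -> op) := \sum_k hnorm (ev (beta k)) ^+ 2.

Lemma source_energy beta : (forall k j, A (beta k j)) ->
  \sum_t hnorm (ev (source beta t)) ^+ 2 <= lam * N + C ^+ 2 * family_energy beta.
Proof.
move=> Abeta; rewrite big_sumType /= !mulr_sumr lerD //.
  apply: ler_sum => j _; rewrite row_evalZ //; last exact: unit_row_in.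
  by rewrite row_eval_unit // hnormsq_real sqr_sqrtr.
apply: ler_sum => k _; rewrite row_eval_comp //; exact: mnorm_bound.
Qed.

(** The matrix [W] is a scalar contraction, hence acts contractively on the vectors obtained
by evaluating rows. *)
Lemma transfer_energy beta : (forall k j, A (beta k j)) ->
  \sum_s hnorm (ev (transfer beta s)) ^+ 2 <= lam * N + C ^+ 2 * family_energy beta.
Proof.
move=> Abeta; apply: le_trans (source_energy Abeta).
have e s : ev (transfer beta s) = \sum_t W s t *: ev (source beta t).
  by apply: row_eval_sum => // t j; exact: source_in.
under eq_bigr => s _ do rewrite e.
exact: Wcontr.
Qed.

Lemma transfer_split beta : (forall k j, A (beta k j)) ->
  \sum_i hnorm (ev (transfer beta (inl i))) ^+ 2 + c ^+ 2 * family_energy (feedback beta)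
  = \sum_s hnorm (ev (transfer beta s)) ^+ 2.
Proof.
move=> Abeta; rewrite big_sumType /=; congr (_ + _); rewrite mulr_sumr.
apply: eq_bigr => k _; rewrite row_evalZ //; last exact: transfer_in.
by rewrite hnormsq_real mulrA -exprMn mulfV ?expr1n ?mul1r // gt_eqF // (lt_trans ltr01).
Qed.

Lemma N_ge0 : 0 <= N.
Proof. by apply: sumr_ge0 => j _; exact: sqr_ge0. Qed.

(** Each step multiplies the previous bound by [C ^+ 2] and adds [lam * N]. *)
Lemma approx_energy s : 1 <= C ->
  family_energy (approx s) <= lam * N * s%:R * C ^+ 2 ^+ s.
Proof.
move=> C1; elim: s => [|s ih].
  rewrite mulr0 mul0r /family_energy big1 // => k _.
  by rewrite /row_eval big1 ?hnorm0 ?expr0n // => j _; rewrite (morphism0 hu).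
have hs := approx_in s; have := transfer_energy hs; rewrite -transfer_split //.
have p0 : 0 <= \sum_i hnorm (ev (transfer (approx s) (inl i))) ^+ 2.
  by apply: sumr_ge0 => i _; exact: sqr_ge0.
have f0 : 0 <= family_energy (feedback (approx s)).
  by apply: sumr_ge0 => i _; exact: sqr_ge0.
move=> h; rewrite -[approx s.+1]/(feedback (approx s)).
have c2 : 1 <= c ^+ 2 by rewrite exprn_ege1 // ltW.
have C2 : 1 <= C ^+ 2 ^+ s.+1 by rewrite !exprn_ege1.
have N0 := N_ge0; have lN : 0 <= lam * N by rewrite mulr_ge0.
have h1 : family_energy (feedback (approx s)) <= c ^+ 2 * family_energy (feedback (approx s)).
  by rewrite ler_peMl.
have h2 : C ^+ 2 * family_energy (approx s) <= C ^+ 2 * (lam * N * s%:R * C ^+ 2 ^+ s).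
  by rewrite ler_wpM2l ?sqr_ge0.
have h3 : lam * N <= lam * N * C ^+ 2 ^+ s.+1 by rewrite ler_peMr.
have e : lam * N * s.+1%:R * C ^+ 2 ^+ s.+1 =
   lam * N * C ^+ 2 ^+ s.+1 + C ^+ 2 * (lam * N * s%:R * C ^+ 2 ^+ s).
  by rewrite -natr1 exprS; ring.
by rewrite e; lra.
Qed.

Lemma truncation_energy s : 1 <= C ->
  \sum_i hnorm (ev (transfer (approx s) (inl i))) ^+ 2 <= lam * s.+1%:R * C ^+ 2 ^+ s.+1 * N.
Proof.
move=> C1; have hs := approx_in s; have := transfer_energy hs; rewrite -transfer_split //.
have f0 : 0 <= c ^+ 2 * family_energy (feedback (approx s)).
  by rewrite mulr_ge0 ?sqr_ge0 //; apply: sumr_ge0 => i _; exact: sqr_ge0.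
have C2 : 1 <= C ^+ 2 ^+ s.+1 by rewrite !exprn_ege1.
have N0 := N_ge0; have lN : 0 <= lam * N by rewrite mulr_ge0.
have h2 : C ^+ 2 * family_energy (approx s) <= C ^+ 2 * (lam * N * s%:R * C ^+ 2 ^+ s).
  by rewrite ler_wpM2l ?sqr_ge0 // approx_energy.
have h3 : lam * N <= lam * N * C ^+ 2 ^+ s.+1 by rewrite ler_peMr.
have e : lam * s.+1%:R * C ^+ 2 ^+ s.+1 * N =
   lam * N * C ^+ 2 ^+ s.+1 + C ^+ 2 * (lam * N * s%:R * C ^+ 2 ^+ s).
  by rewrite -natr1 exprS; ring.
by rewrite e; lra.
Qed.

End Estimates.

Section Remainder.
Variable zeta : 'I_n -> H0.
Local Notation ev v := (row_eval id v zeta).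
Let N := \sum_j hnorm (zeta j) ^+ 2.
Let hid := morphism_inclusion.

Lemma inclusion_bound g : A g -> (opnorm g <= 1)%E ->
  forall h : H0, hnorm (g h) ^+ 2 <= hnorm h ^+ 2.
Proof.
move=> Ag g1 h; have := opnorm_bound (morphism_linear hid Ag) ler01 g1 h.
by rewrite expr1n mul1r.
Qed.

Definition defect_energy s := \sum_k hnorm (ev (b k - approx s k)) ^+ 2.

(** Evaluated in the given Hilbert space, where the [a k] are contractions, the factorization
bounds [c ^+ 2 * E] by [lam * N + E], for [E] the energy of [b]. *)
Lemma limit_energy : (c ^+ 2 - 1) * \sum_k hnorm (ev (b k)) ^+ 2 <= lam * N.
Proof.
have h1 : (mnorm A (H := H0) id <= 1%:E)%E by apply: ge_ereal_sup => _ [g [_ /= g1] <-].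
have := transfer_energy zeta hid ler01 h1 Ab.
rewrite expr1n mul1r -/N /family_energy.
have e : \sum_s hnorm (ev (transfer b s)) ^+ 2 =
    \sum_i hnorm (ev (x i)) ^+ 2 + c ^+ 2 * \sum_k hnorm (ev (b k)) ^+ 2.
  rewrite big_sumType /=; congr (_ + _).
    by apply: eq_bigr => i _; rewrite -xb.
  rewrite mulr_sumr; apply: eq_bigr => k _; rewrite -xb /= row_evalZ // hnormsq_real //.
rewrite e; have : 0 <= \sum_i hnorm (ev (x i)) ^+ 2.
  by apply: sumr_ge0 => i _; exact: sqr_ge0.
by rewrite mulrBl mul1r => h2 h3; lra.
Qed.

(** The difference of two inputs cancels the unit rows, so that only [a k (b k - approx s k)]
is left to be mapped by [W]. *)
Lemma defect_step s :
  \sum_i hnorm (ev (x i - transfer (approx s) (inl i))) ^+ 2 + c ^+ 2 * defect_energy s.+1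
  <= defect_energy s.
Proof.
have As := approx_in s.
pose g : 'I_n + K -> H0 := fun t =>
  match t with inl _ => 0 | inr k => a k (ev (b k - approx s k)) end.
have AB k j : A ((b k - approx s k) j) by apply: opalgB.
have dif t : ev (source b t) - ev (source (approx s) t) = g t.
  case: t => [i|k] /=; first by rewrite subrr.
  rewrite !(row_eval_comp hid) // (row_evalB hid) //.
  have ul := morphism_linear hid (Aa k).
  by rewrite addrC -scaleN1r -ul scaleN1r addrC.
have difW t : ev (transfer b t) - ev (transfer (approx s) t) = \sum_r W t r *: g r.
  rewrite /transfer !(row_eval_sum hid); [|exact: source_in|exact: source_in].
  by rewrite -sumrB; apply: eq_bigr => r _; rewrite -scalerBr dif.
have gE : \sum_t hnorm (g t) ^+ 2 <= defect_energy s.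
  rewrite big_sumType /= [X in X + _]big1 ?add0r => [|i _]; last by rewrite hnorm0 expr0n.
  by apply: ler_sum => k _; apply: inclusion_bound.
apply: le_trans gE; apply: le_trans (Wcontr g).
rewrite big_sumType /= lerD //.
  apply: ler_sum => i _; rewrite (row_evalB hid) //; last by move=> j; exact: transfer_in.
  by rewrite -difW -xb.
rewrite mulr_sumr; apply: ler_sum => k _.
rewrite -difW -xb -[sum_family _ _ _]/(toC c *: b k) (row_evalZ hid) //.
have -> : ev (transfer (approx s) (inr k)) = toC c *: ev (approx s.+1 k).
  rewrite (row_evalZ hid); last by move=> j; exact: transfer_in.
  by rewrite scalerA -rmorphM /= mulfV ?scale1r // gt_eqF // (lt_trans ltr01).
rewrite -scalerBr hnormsq_real (row_evalB hid) //.
by move=> j; exact: (approx_in s.+1).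
Qed.

Lemma defect_decay s : c ^+ 2 ^+ s * defect_energy s <= defect_energy 0.
Proof.
elim: s => [|s ih]; first by rewrite expr0 mul1r.
apply: le_trans ih; rewrite [_ ^+ s.+1]exprSr -mulrA ler_wpM2l ?(exprn_ge0 _ (sqr_ge0 c)) //.
apply: le_trans (defect_step s); rewrite lerDr.
by apply: sumr_ge0 => i _; exact: sqr_ge0.
Qed.

Lemma remainder_energy s :
  c ^+ 2 ^+ s * (c ^+ 2 - 1) * \sum_i hnorm (ev (x i - transfer (approx s) (inl i))) ^+ 2
  <= lam * N.
Proof.
have c2 : 0 <= c ^+ 2 - 1 by rewrite subr_ge0 exprn_ege1 // ltW.
apply: le_trans limit_energy; rewrite mulrAC mulrC ler_wpM2l //.
have -> : \sum_k hnorm (ev (b k)) ^+ 2 = defect_energy 0.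
  by apply: eq_bigr => k _; congr (hnorm (ev _) ^+ 2); rewrite /approx /= subr0.
apply: le_trans (defect_decay s); rewrite ler_wpM2l ?(exprn_ge0 _ (sqr_ge0 c)) //.
apply: le_trans (defect_step s); rewrite lerDl mulr_ge0 ?sqr_ge0 //.
by apply: sumr_ge0 => k _; exact: sqr_ge0.
Qed.

End Remainder.

End Truncation.

End MorphismEvaluation.

(** * Amplification bounds from a uniform factorization *)

Section RowFactorization.
Variables (R : realType) (H0 : hilbertType R) (A : set (H0 -> H0)).
Hypothesis hA : unital_operator_algebra A.
Local Notation toC := (real_complex R).
Local Notation op := (H0 -> H0).

Definition contraction_multiple n (b b' : 'I_n -> op) : Prop :=
  exists a, [/\ A a, (opnorm a <= 1)%E, (forall j, A (b j)) & b' = (fun j => a \o b j)].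

Lemma contraction_multipleZ n (t : R) (b b' : 'I_n -> op) :
  contraction_multiple b b' -> contraction_multiple (toC t *: b) (toC t *: b').
Proof.
move=> [a [Aa a1 Ab ->]]; exists a; split=> // [j|]; first exact: opalgZ.
apply/funext => j; apply/funext => h /=.
have al := morphism_linear (morphism_inclusion hA) Aa.
by rewrite -[RHS]/(a (toC t *: b j h)) (linear_opZ al).
Qed.

(** The functionals [w |-> <w j h, y>] separate rows. *)
Lemma row_separated n (v : 'I_n -> op) : v != 0 -> exists2 phi, scalar phi & phi v != 0.
Proof.
move=> v0.
have [j [h vjh]] : exists j h, v j h != 0.
  apply: contrapT => hn; move/eqP: v0; apply; apply/funext => j; apply/funext => h.
  by apply/eqP; apply: contrapT => /negP hv; apply: hn; exists j, h.
exists (fun w => hdot (w j h) (v j h)); last by rewrite hdotE expf_neq0 // normr_eq0.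
by move=> k w w'; rewrite -[(k *: w + w') j h]/(k *: w j h + w' j h) linearDl linearZl_LR.
Qed.

Definition factorizes (c lam : R) n (x : 'I_n -> 'I_n -> op) :=
  sos_cone c (@contraction_multiple n)
    (lam *: unit_sos (@unit_row R H0 n) - \sum_i square (x i)).

Lemma factorizes_split (c lam : R) n (x : 'I_n -> 'I_n -> op) (s : nat) :
  1 < c -> 0 <= lam -> (forall i j, A (x i j)) -> factorizes c lam x ->
  exists y : 'I_n -> 'I_n -> op,
    [/\ forall i j, A (y i j),
        forall (H : hilbertType R) (u : op -> H -> H) (C : R) (zeta : 'I_n -> H),
          morphism A u -> 1 <= C -> (mnorm A u <= C%:E)%E ->
          \sum_i hnorm (row_eval u (y i) zeta) ^+ 2 <=
            lam * s.+1%:R * C ^+ 2 ^+ s.+1 * \sum_j hnorm (zeta j) ^+ 2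
      & forall zeta : 'I_n -> H0,
          c ^+ 2 ^+ s * (c ^+ 2 - 1) * \sum_i hnorm (row_eval id (x i - y i) zeta) ^+ 2 <=
            lam * \sum_j hnorm (zeta j) ^+ 2].
Proof.
move=> c1 lam0 Ax fx.
have [K [b [b' [W [hG xb Wcontr]]]]] := sos_factorization lam0 (@row_separated n) fx.
have /choice [a ha] : forall k, exists a,
  [/\ A a, (opnorm a <= 1)%E, (forall j, A (b k j)) & b' k = (fun j => a \o b k j)] := hG.
have Aa k : A (a k) by case: (ha k).
have a1 k : (opnorm (a k) <= 1)%E by case: (ha k).
have Ab k : forall j, A (b k j) by case: (ha k).
have xb' i : sum_family x (fun k => toC c *: b k) i = transfer lam W a b i.
  rewrite xb; apply: eq_bigr => t _; congr (_ *: _).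
  by case: t => [j //|k]; have [_ _ _ hk] := ha k; rewrite /= hk.
exists (fun i => transfer lam W a (approx c lam W a s) (inl i)); split.
- move=> i j; apply: (transfer_in hA lam W Aa) => k j'; exact: (approx_in hA).
- move=> H u C zeta hu C1 uC; have C0 : 0 <= C := le_trans ler01 C1.
  exact: (truncation_energy hA c1 lam0 Wcontr Aa a1 zeta hu C0 uC s C1).
- move=> zeta; exact: (remainder_energy hA c1 lam0 Wcontr Aa a1 Ab Ax xb' zeta s).
Qed.

Lemma mxopnorm_inclusion n (x : 'I_n -> 'I_n -> op) M : 0 <= M -> (forall i j, A (x i j)) ->
  (mxopnorm (\matrix_(i, j) x i j) <= M%:E)%E <->
  forall zeta : 'I_n -> H0,
    \sum_i hnorm (row_eval id (x i) zeta) ^+ 2 <= M ^+ 2 * \sum_j hnorm (zeta j) ^+ 2.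
Proof.
move=> M0 Ax.
have e zeta : \sum_i hnorm (row_eval id (x i) zeta) ^+ 2 =
    \sum_i hnorm (\sum_j (\matrix_(i, j) x i j) i j (zeta j)) ^+ 2.
  apply: eq_bigr => i _; congr (hnorm _ ^+ 2).
  by apply: eq_bigr => j _; rewrite mxE.
split=> [h zeta|h].
  rewrite e; apply: (mxopnorm_bound _ M0 h) => i j; rewrite mxE.
  exact: (morphism_linear (morphism_inclusion hA)).
by apply: mxopnorm_le => // zeta; rewrite -e.
Qed.

Definition matrix_ball n (x : 'I_n -> 'I_n -> op) :=
  (forall i j, A (x i j)) /\ (mxopnorm (\matrix_(i, j) x i j) <= 1)%E.

Lemma matrix_ballP n (x : 'I_n -> 'I_n -> op) : matrix_ball x <->
  (forall i j, A (x i j)) /\ forall zeta : 'I_n -> H0,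
    \sum_i hnorm (row_eval id (x i) zeta) ^+ 2 <= \sum_j hnorm (zeta j) ^+ 2.
Proof.
split=> -[Ax hx]; split=> //.
  by move=> zeta; have := (mxopnorm_inclusion ler01 Ax).1 hx zeta; rewrite expr1n mul1r.
by apply/(mxopnorm_inclusion ler01 Ax) => zeta; rewrite expr1n mul1r.
Qed.

Lemma opnorm_entry n (x : 'I_n -> 'I_n -> op) i j : matrix_ball x -> (opnorm (x i j) <= 1)%E.
Proof.
move=> /matrix_ballP [Ax hx]; apply: opnorm_le => // h; rewrite expr1n mul1r.
pose zeta k : H0 := if k == j then h else 0.
have hid := morphism_inclusion hA.
have ez k : row_eval id (x k) zeta = x k j h.
  rewrite /row_eval (bigD1 j) //= big1 => [|l lj]; first by rewrite addr0 /zeta eqxx.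
  by rewrite /zeta (negbTE lj) (linear_op0 (morphism_linear hid (Ax _ _))).
have ezeta : \sum_l hnorm (zeta l) ^+ 2 = hnorm h ^+ 2.
  rewrite (bigD1 j) //= big1 => [|l lj]; first by rewrite /zeta eqxx addr0.
  by rewrite /zeta (negbTE lj) hnorm0 expr0n.
rewrite -ezeta; apply: le_trans (hx zeta).
rewrite (bigD1 i) //= ez lerDl; apply: sumr_ge0 => l _; exact: sqr_ge0.
Qed.

(** This makes the supremum over the ball finite, for each fixed [n]. *)
Lemma crude_amplification (H : hilbertType R) (u : op -> H -> H) C n (x : 'I_n -> 'I_n -> op) zeta :
  morphism A u -> 0 <= C -> (mnorm A u <= C%:E)%E -> matrix_ball x ->
  \sum_i hnorm (row_eval u (x i) zeta) ^+ 2 <= (n * 2 ^ n)%:R * C ^+ 2 * \sum_j hnorm (zeta j) ^+ 2.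
Proof.
move=> hu C0 uC hx; have [Ax _] := hx.
have sumsq (T : finType) (v : T -> H) :
    hnorm (\sum_t v t) ^+ 2 <= (2 ^ #|T|)%:R * \sum_t hnorm (v t) ^+ 2.
  have key (r : seq T) : hnorm (\sum_(t <- r) v t) ^+ 2 <=
      (2 ^ size r)%:R * \sum_(t <- r) hnorm (v t) ^+ 2.
    elim: r => [|t r ih]; first by rewrite !big_nil hnorm0 expr0n mulr0.
    rewrite !big_cons /=; set p := v t; set q := \sum_(_ <- _) _.
    have := hnormsq_parallelogram p q; have := sqr_ge0 (hnorm (p - q)) => h1 h2.
    have h3 : (1 : R) <= (2 ^ size r)%:R by rewrite ler1n expn_gt0.
    have h4 := sqr_ge0 (hnorm p).
    have h5 : hnorm p ^+ 2 <= (2 ^ size r)%:R * hnorm p ^+ 2 by rewrite ler_peMl.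
    by rewrite expnS natrM mulrDr; lra.
  by have := key (enum T); rewrite !big_enum -cardT.
have rowb i : hnorm (row_eval u (x i) zeta) ^+ 2 <=
    (2 ^ n)%:R * C ^+ 2 * \sum_j hnorm (zeta j) ^+ 2.
  apply: le_trans (sumsq _ _) _; rewrite card_ord -mulrA ler_wpM2l ?ler0n //.
  rewrite mulr_sumr; apply: ler_sum => j _.
  by apply: (mnorm_bound hu C0 uC) => //; exact: opnorm_entry.
apply: le_trans (ler_sum _ (fun i _ => rowb i)) _.
by rewrite sumr_const card_ord -[leLHS]mulr_natl natrM !mulrA.
Qed.

(** A matrix [x] in the ball is a truncation plus a remainder [r / 2] with [r] in the ball, so
the supremum over the ball is at most [2 M N] plus half of itself. *)
Lemma factorizes_bound (c lam : R) (s : nat) : 1 < c -> 0 <= lam ->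
  4 * lam <= c ^+ 2 ^+ s * (c ^+ 2 - 1) ->
  (forall n (x : 'I_n -> 'I_n -> op), matrix_ball x -> factorizes c lam x) ->
  forall (H : hilbertType R) (u : op -> H -> H) (C : R) n (x : 'I_n -> 'I_n -> op) zeta,
    morphism A u -> 1 <= C -> (mnorm A u <= C%:E)%E -> matrix_ball x ->
    \sum_i hnorm (row_eval u (x i) zeta) ^+ 2 <=
      4 * (lam * s.+1%:R * C ^+ 2 ^+ s.+1) * \sum_j hnorm (zeta j) ^+ 2.
Proof.
move=> c1 lam0 hs hfac H u C n x zeta hu C1 uC hx.
set M := lam * _ * _; set N := \sum_j hnorm (zeta j) ^+ 2.
have C0 : 0 <= C := le_trans ler01 C1.
have N0 : 0 <= N by apply: sumr_ge0 => j _; exact: sqr_ge0.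
pose X : set R :=
  [set r | exists2 x, matrix_ball x & r = \sum_i hnorm (row_eval u (x i) zeta) ^+ 2].
have supX : has_sup X.
  split; first by exists (\sum_i hnorm (row_eval u (x i) zeta) ^+ 2); exists x.
  exists ((n * 2 ^ n)%:R * C ^+ 2 * N) => _ [x0 hx0 ->].
  exact: crude_amplification.
have xsup x' : matrix_ball x' -> \sum_i hnorm (row_eval u (x' i) zeta) ^+ 2 <= sup X.
  by move=> hx'; apply: ub_le_sup; [case: supX|exists x'].
suff hsup : sup X <= 2 * (M * N) + sup X / 2.
  by apply: le_trans (xsup x hx) _; lra.
apply: ge_sup => [|_ [x' hx' ->]]; first by case: supX.
have [Ax' x'1] := (matrix_ballP x').1 hx'.
have [y [Ay yM yr]] := factorizes_split s c1 lam0 Ax' (hfac _ _ hx').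
(* the factor two absorbs the bound [1 / 2] on the remainder *)
pose r i : 'I_n -> op := toC 2 *: (x' i - y i).
have Axy i j : A ((x' i - y i) j) by apply: opalgB.
have hid := morphism_inclusion hA.
have hr : matrix_ball r.
  apply/matrix_ballP; split=> [i j|z]; first exact: opalgZ.
  under eq_bigr => i _ do rewrite (row_evalZ hA hid) // hnormsq_real.
  rewrite -mulr_sumr; set S := \sum_i _; set Z := \sum_j _.
  have S0 : 0 <= S by apply: sumr_ge0 => i _; exact: sqr_ge0.
  have Z0 : 0 <= Z by apply: sumr_ge0 => i _; exact: sqr_ge0.
  have hSZ : c ^+ 2 ^+ s * (c ^+ 2 - 1) * S <= lam * Z := yr z.
  have h4 : 4 * lam * S <= lam * Z by apply: le_trans hSZ; rewrite ler_wpM2r.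
  (* [lam] cannot be cancelled when it is zero; the remainder then vanishes *)
  have [lz|ln0] := eqVneq lam 0.
    rewrite lz mul0r in hSZ.
    have c2 : 1 < c ^+ 2 by rewrite exprn_egt1.
    have p0 : 0 < c ^+ 2 ^+ s * (c ^+ 2 - 1).
      by rewrite mulr_gt0 ?subr_gt0 // exprn_gt0 // (lt_trans ltr01).
    have -> : S = 0; last by rewrite mulr0.
    by apply/eqP; rewrite eq_le S0 andbT -(ler_pM2l p0) mulr0.
  have lp : 0 < lam by rewrite lt_neqAle eq_sym ln0.
  by rewrite -(ler_pM2l lp); apply: le_trans h4; rewrite expr2; lra.
have xyr i : row_eval u (x' i) zeta = row_eval u (y i) zeta + row_eval u (x' i - y i) zeta.
  by rewrite (row_evalB hA hu) // addrC subrK.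
have rE i : hnorm (row_eval u (r i) zeta) ^+ 2 = 4 * hnorm (row_eval u (x' i - y i) zeta) ^+ 2.
  by rewrite (row_evalZ hA hu) // hnormsq_real expr2; congr (_ * _); ring.
have hi i : hnorm (row_eval u (x' i) zeta) ^+ 2 <=
   2 * hnorm (row_eval u (y i) zeta) ^+ 2 + hnorm (row_eval u (r i) zeta) ^+ 2 / 2.
  rewrite rE xyr; set p := row_eval u (y i) zeta; set q := row_eval u _ _.
  by have := hnormsq_parallelogram p q; have := sqr_ge0 (hnorm (p - q)); lra.
apply: le_trans (ler_sum _ (fun i _ => hi i)) _.
rewrite big_split /= -mulr_sumr -mulr_suml lerD ?ler_pM2l ?ler_pM2r ?invr_gt0 //.
  exact: yM.
exact: xsup.
Qed.

End RowFactorization.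

(** * Representations on the completion of a quadratic form *)

Section BitransposeAlgebra.
Variables (R : realType) (V : lmodType R[i]) (Q : quadForm V).

Lemma bitranspose_id (T : bmap Q Q) F : (forall v, T v = v) -> bitranspose T F = F.
Proof.
move=> TE; apply: dual_eq => f /=; congr (dual_fun F _).
by apply: dual_eq => v /=; rewrite TE.
Qed.

Lemma bitranspose_comp (T T1 T2 : bmap Q Q) F : (forall v, T v = T1 (T2 v)) ->
  bitranspose T F = bitranspose T1 (bitranspose T2 F).
Proof.
move=> TE; apply: dual_eq => f /=; congr (dual_fun F _).
by apply: dual_eq => v /=; rewrite TE.
Qed.

Lemma bitranspose_lin k (T T1 T2 : bmap Q Q) F : (forall v, T v = k *: T1 v + T2 v) ->
  bitranspose T F = k *: bitranspose T1 F + bitranspose T2 F.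
Proof.
move=> TE; apply: dual_eq => f.
change (F (transpose T f) = F (transpose T1 (k *: f)) + F (transpose T2 f)).
rewrite -(dual_funD (dualP F)); congr (dual_fun F _); apply: dual_eq => v.
change (f (T v) = f (k *: T1 v) + f (T2 v)).
by rewrite TE (dual_funD (dualP f)).
Qed.
End BitransposeAlgebra.

Section Representation.
Variables (R : realType) (H0 : hilbertType R) (A : set (H0 -> H0)).
Hypothesis hA : unital_operator_algebra A.
Local Notation toC := (real_complex R).
Local Notation op := (H0 -> H0).

Lemma opnorm_scale (M : R) (a : op) : 0 < M -> A a -> (opnorm a <= M%:E)%E ->
  (opnorm (toC M^-1 *: a) <= 1)%E.
Proof.
move=> M0 Aa aM; apply: opnorm_le => // h; rewrite expr1n mul1r.
have al := morphism_linear (morphism_inclusion hA) Aa.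
have aMh := opnorm_bound al (ltW M0) aM h.
rewrite -[(toC M^-1 *: a) h]/(toC M^-1 *: a h) hnormsq_real exprVn mulrC.
by rewrite ler_pdivrMr ?exprn_gt0 // mulrC.
Qed.

Section GNS.
Variables (V : lmodType R[i]) (Q : quadForm V) (c : R) (act : op -> V -> V).
Hypotheses (c0 : 0 <= c) (act_linear : forall a, A a -> linear (act a))
  (act_id : forall v, act idfun v = v)
  (act_lin : forall k a b v, A a -> A b -> act (k *: a + b) v = k *: act a v + act b v)
  (act_comp : forall a b v, A a -> A b -> act (a \o b) v = act a (act b v))
  (act_bound : forall a v, A a -> (opnorm a <= 1)%E -> Q (act a v) <= c ^+ 2 * Q v).

Lemma act_bounded a : A a -> exists M, forall v, Q (act a v) <= M * Q v.
Proof.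
move=> Aa; have [M M0 aM] := opnorm_finite (opalg_bounded hA Aa).
exists (M ^+ 2 * c ^+ 2) => v.
have aE : act a v = toC M *: act (toC M^-1 *: a) v + act 0 v.
  rewrite -act_lin; [|exact: opalgZ|exact: opalg0].
  by rewrite scalerA -rmorphM /= mulfV ?gt_eqF // scale1r addr0.
have z : act 0 v = 0.
  have := act_lin (-1) v (opalg_id hA) (opalg_id hA).
  by rewrite !scaleN1r !addNr.
rewrite aE z addr0 (quad_real (qformP Q)) -mulrA ler_wpM2l ?sqr_ge0 //.
by apply: act_bound; [exact: opalgZ|exact: opnorm_scale].
Qed.

Definition act_bmap a (Aa : A a) : bmap Q Q := BMap (act_linear Aa) (act_bounded Aa).

Definition bidual_rep (a : op) (F : bidual Q) : bidual Q :=
  if pselect (A a) is left Aa then bitranspose (act_bmap Aa) F else F.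

Lemma bidual_repE a (Aa : A a) F : bidual_rep a F = bitranspose (act_bmap Aa) F.
Proof. by rewrite /bidual_rep; case: pselect => // Aa'; rewrite (Prop_irrelevance Aa' Aa). Qed.

Lemma bidual_rep_evaluation a v : A a -> bidual_rep a (evaluation Q v) = evaluation Q (act a v).
Proof. by move=> Aa; rewrite (bidual_repE Aa) bitranspose_evaluation. Qed.

Lemma bidual_rep_opnorm a : A a -> (opnorm a <= 1)%E -> (opnorm (bidual_rep a) <= c%:E)%E.
Proof.
move=> Aa a1; apply: opnorm_le => // F; rewrite (bidual_repE Aa).
apply: (@bitranspose_bound R V Q (act_bmap Aa) (c ^+ 2) F (sqr_ge0 c)) => v; exact: act_bound.
Qed.

Lemma bidual_rep_morphism : morphism A bidual_rep.
Proof.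
split.
- move=> a Aa; split.
    move=> k F G; rewrite !(bidual_repE Aa); exact: (bmap_linear (bitranspose (act_bmap Aa))).
  have [M TM] := act_bounded Aa.
  apply: (@le_lt_trans _ _ (Num.sqrt `|M|)%:E%E); last exact: ltry.
  apply: opnorm_le => [|F]; first exact: sqrtr_ge0.
  rewrite (sqr_sqrtr (normr_ge0 M)) (bidual_repE Aa).
  apply: (@bitranspose_bound R V Q (act_bmap Aa) `|M| F (normr_ge0 M)) => v.
  apply: le_trans (TM v) _; rewrite ler_wpM2r ?ler_norm //; exact: (quad_ge0 (qformP Q)).
- apply/funext => F; rewrite (bidual_repE (opalg_id hA)); apply: bitranspose_id => v.
  exact: act_id.
- move=> k a b Aa Ab; apply/funext => F.
  rewrite (bidual_repE (opalg_lin hA k Aa Ab)).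
  rewrite -[RHS]/(k *: bidual_rep a F + bidual_rep b F) (bidual_repE Aa) (bidual_repE Ab).
  by apply: bitranspose_lin => v; exact: act_lin.
- move=> a b Aa Ab; apply/funext => F; rewrite /= (bidual_repE (opalg_comp hA Aa Ab)).
  rewrite (bidual_repE Aa) (bidual_repE Ab).
  by apply: bitranspose_comp => v; exact: act_comp.
Qed.

Lemma bidual_rep_mnorm : (mnorm A bidual_rep <= c%:E)%E.
Proof. by apply: ge_ereal_sup => _ [a [/= Aa a1] <-]; exact: bidual_rep_opnorm. Qed.

End GNS.

Section SingleForm.
Variables (c : R) (n : nat).
Local Notation rowv := ('I_n -> op).
Definition row_in : set rowv := [set v | forall j, A (v j)].

(** Each entry of a row is a multiple of a contraction, so that the row is a sum of multiples
of products of contractions with unit rows. *)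
Lemma row_dominated (v : rowv) : row_in v ->
  sos_dominated c (@contraction_multiple R H0 A n) (@unit_row R H0 n) v.
Proof.
move=> Av.
have GZ := @contraction_multipleZ R H0 A hA n.
have zero : sos_dominated c (@contraction_multiple R H0 A n) (@unit_row R H0 n) 0.
  exists 0 => //; rewrite scale0r sub0r.
  have -> : - square (0 : rowv) = square 0.
    by apply/funext => phi; rewrite !fctE /square functional0 (sqmod_real 0) expr0n oppr0.
  exact: sos_square.
pose single j : rowv := fun i => if i == j then v j else 0.
have -> : v = \sum_j single j.
  apply/funext => i; rewrite sum_funE (bigD1 i) //= big1 ?addr0 => [|j ji].
    by rewrite /single eqxx.
  by rewrite /single eq_sym (negbTE ji).
apply: big_ind => // [w w'|j _]; first exact: sos_dominatedD.
have [M M0 aM] := opnorm_finite (opalg_bounded hA (Av j)).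
pose a := toC M^-1 *: v j.
have Aa : A a by exact: opalgZ.
have al := morphism_linear (morphism_inclusion hA) Aa.
have -> : single j = toC M *: (fun i => a \o unit_row j i).
  apply/funext => i; apply/funext => h.
  rewrite -[RHS]/(toC M *: a (unit_row j i h)) /single /unit_row.
  case: eqP => _ /=; last by rewrite (linear_op0 al) scaler0.
  by rewrite scalerA -rmorphM /= mulfV ?gt_eqF // scale1r.
apply: (sos_dominated_generator c GZ (j := j) (ltW M0)).
exists a; split=> // [|i]; first exact: opnorm_scale.
exact: unit_row_in.
Qed.

Lemma form_of_not_factorizes (lam : R) (x : 'I_n -> rowv) : (forall i, row_in (x i)) ->
  ~ factorizes A c lam x ->
  exists Q : rowv -> R,
    [/\ quadratic_on row_in Q,
        forall a b, A a -> (opnorm a <= 1)%E -> row_in b ->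
          Q (fun j => a \o b j) <= c ^+ 2 * Q b,
        \sum_j Q (unit_row j) = 1 & lam <= \sum_i Q (x i)].
Proof.
move=> Ax nf.
have [|||j||Q [Q1 Q2 Q3 Q4]] := quadratic_separation (S := row_in) (I := 'I_n)
   (@contraction_multipleZ R H0 A hA n) _ _ _ _ _ nf.
- by move=> k v w Av Aw j; exact: (opalg_lin hA).
- exact: row_dominated.
- by move=> b b' [a [Aa a1 Ab ->]]; split=> // j; exact: (opalg_comp hA).
- by move=> i; exact: unit_row_in.
- exact: Ax.
by exists Q; split=> // a b Aa a1 Ab; apply: Q2; exists a.
Qed.

End SingleForm.

End Representation.

(** * Direct sums of quadratic forms and the uniform constant *)

Section BlockSum.
Variables (R : realType) (H0 : hilbertType R) (A : set (H0 -> H0)).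
Variable hA : unital_operator_algebra A.
Local Notation toC := (real_complex R).
Local Notation op := (H0 -> H0).

Definition finite_blocks (s : nat -> nat -> op) :=
  (forall m j, A (s m j)) /\ exists N, forall m, (N <= m)%N -> s m = 0.

(** The proof argument lets the closure of this predicate under linear combinations be
registered as a canonical instance. *)
Definition block_pred (_ : unital_operator_algebra A) : {pred nat -> nat -> op} :=
  fun s => `[< finite_blocks s >].

Lemma block_submod_closed : submod_closed (block_pred hA).
Proof.
split=> [|k s t /asboolP [As [N sN]] /asboolP [At [M tM]]]; apply/asboolP.
  by split=> [m j|]; [exact: opalg0|exists 0%N].
split=> [m j|]; first exact: (opalg_lin hA).
exists (maxn N M) => m; rewrite geq_max => /andP[Nm Mm].
by rewrite -[LHS]/(k *: s m + t m) sN // tM // scaler0 addr0.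
Qed.

HB.instance Definition _ := GRing.isSubmodClosed.Build R[i] (nat -> nat -> op) (block_pred hA)
  block_submod_closed.

Record blocks := Blocks { block_fun :> nat -> nat -> op; _ : block_fun \in block_pred hA }.
HB.instance Definition _ := [isSub for block_fun].
HB.instance Definition _ := [Choice of blocks by <:].
HB.instance Definition _ := [SubChoice_isSubLmodule of blocks by <:].

Lemma blocksP (s : blocks) : finite_blocks s.
Proof. by case: s => s /= /asboolP. Qed.

Definition mkBlocks s (hs : finite_blocks s) : blocks := Blocks (asboolT hs).

Lemma blocks_eq (s t : blocks) : (forall m, s m = t m) -> s = t.
Proof. by move=> h; apply: val_inj; apply/funext. Qed.

Variables (n : nat -> nat) (Qm : forall m, ('I_(n m) -> op) -> R) (c : R).
Hypothesis c0 : 0 <= c.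
Hypothesis Qquad : forall m, quadratic_on (row_in A (n := n m)) (Qm (m := m)).
Hypothesis Qmul : forall m a b, A a -> (opnorm a <= 1)%E -> row_in A b ->
  Qm (m := m) (fun j => a \o b j) <= c ^+ 2 * Qm b.

(** The form number [m] only sees the first [n m] entries of the block number [m], which lets
forms on rows of different lengths live on the same space of double sequences. *)
Definition block_row (s : nat -> nat -> op) m : 'I_(n m) -> op := fun j => s m j.
Arguments block_row : clear implicits.

Lemma block_row_in (s : blocks) m : row_in A (block_row s m).
Proof. by move=> j; have [As _] := blocksP s; exact: As. Qed.

Definition block_bound (s : blocks) : nat := projT1 (cid (blocksP s).2).

Definition block_form (s : blocks) : R :=
  \sum_(0 <= m < block_bound s) Qm (block_row s m).

Lemma block_form0 m : Qm (m := m) 0 = 0.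
Proof.
have A0 : row_in A (0 : 'I_(n m) -> op) by move=> j; exact: opalg0.
by have := quadon_scale (Qquad m) 0 A0; rewrite scaler0 (sqmod_real 0) expr0n mul0r.
Qed.

Lemma block_sum_stable (s : nat -> nat -> op) N N' : (N <= N')%N ->
  (forall m, (N <= m)%N -> s m = 0) ->
  \sum_(0 <= m < N') Qm (block_row s m) = \sum_(0 <= m < N) Qm (block_row s m).
Proof.
move=> NN' sN; rewrite (big_cat_nat (n := N)) //=.
have -> : \sum_(N <= m < N') Qm (block_row s m) = 0; last by rewrite addr0.
rewrite big_nat; apply: big1 => m /andP[Nm _].
by rewrite (_ : block_row s m = 0) ?block_form0 //; apply/funext => j; rewrite /block_row sN.
Qed.

Lemma block_formE (s : blocks) N : (forall m, (N <= m)%N -> s m = 0) ->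
  block_form s = \sum_(0 <= m < N) Qm (block_row s m).
Proof.
move=> sN; rewrite /block_form /block_bound; case: cid => M /= sM.
by rewrite -(block_sum_stable (leq_maxl M N) sM) -(block_sum_stable (leq_maxr M N) sN).
Qed.

Lemma block_form_quadratic : quadratic block_form.
Proof.
split=> [s|s t|k s].
- by apply: sumr_ge0 => m _; apply: (quadon_ge0 (Qquad m)); exact: block_row_in.
- have [[_ [N sN]] [_ [M tM]]] := (blocksP s, blocksP t).
  pose B := maxn N M.
  have sB m : (B <= m)%N -> s m = 0 by rewrite geq_max => /andP[h _]; exact: sN.
  have tB m : (B <= m)%N -> t m = 0 by rewrite geq_max => /andP[_ h]; exact: tM.
  rewrite (block_formE (s := s + t) (N := B)); last first.
    by move=> m Bm; rewrite -[LHS]/(s m + t m) sB ?tB ?addr0.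
  rewrite (block_formE (s := s - t) (N := B)); last first.
    by move=> m Bm; rewrite -[LHS]/(s m - t m) sB ?tB ?subr0.
  rewrite (block_formE sB) (block_formE tB) -!big_split mulr_sumr /=.
  by apply: eq_bigr => m _; apply: (quadon_parallelogram (Qquad m)); exact: block_row_in.
- have [_ [N sN]] := blocksP s.
  rewrite (block_formE (s := k *: s) (N := N)); last first.
    by move=> m Nm; rewrite -[LHS]/(k *: s m) sN ?scaler0.
  rewrite (block_formE sN) mulr_sumr.
  by apply: eq_bigr => m _; exact: (quadon_scale (Qquad m) k (@block_row_in s m)).
Qed.

Definition block_quad : quadForm blocks := QuadForm block_form_quadratic.

Lemma block_act_subproof a (s : blocks) : A a -> finite_blocks (fun m j => a \o s m j).
Proof.
move=> Aa; have [As [N sN]] := blocksP s; split=> [m j|]; first exact: (opalg_comp hA).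
exists N => m Nm; apply/funext => j; apply/funext => h.
rewrite /= sN // -[RHS]/(0 : H0) -[LHS]/(a 0).
exact: (linear_op0 (morphism_linear (morphism_inclusion hA) Aa)).
Qed.

Definition block_act a (s : blocks) : blocks :=
  if pselect (A a) is left Aa then mkBlocks (block_act_subproof s Aa) else s.

Lemma block_actE a (s : blocks) m j : A a -> block_act a s m j = a \o s m j.
Proof. by move=> Aa; rewrite /block_act; case: pselect. Qed.

Lemma block_form_act a (s : blocks) : A a -> (opnorm a <= 1)%E ->
  block_form (block_act a s) <= c ^+ 2 * block_form s.
Proof.
move=> Aa a1; have [_ [N sN]] := blocksP s.
rewrite (block_formE (s := block_act a s) (N := N)); last first.
  move=> m Nm; have [_] := block_act_subproof s Aa; rewrite /block_act.
  move=> _; apply/funext => j; rewrite -/(block_act a s) block_actE // sN //.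
  apply/funext => h; exact: (linear_op0 (morphism_linear (morphism_inclusion hA) Aa)).
rewrite (block_formE sN) mulr_sumr; apply: ler_sum => m _.
have -> : block_row (block_act a s) m = (fun j => a \o block_row s m j).
  by apply/funext => j; rewrite /block_row block_actE.
by apply: Qmul => //; exact: block_row_in.
Qed.

Lemma single_block_subproof m k (v : 'I_k -> op) : row_in A v ->
  finite_blocks (fun m' j => if m' == m then (if insub j is Some i then v i else 0) else 0).
Proof.
move=> Av; split=> [m' j|].
  case: eqP => _; last exact: opalg0.
  by case: insubP => [i _ _|_]; [exact: Av|exact: opalg0].
exists m.+1 => m'; case: eqP => [->|//]; by rewrite ltnn.
Qed.

Definition single_block m k (v : 'I_k -> op) (Av : row_in A v) : blocks :=
  mkBlocks (single_block_subproof m Av).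

Lemma block_form_single m (v : 'I_(n m) -> op) (Av : row_in A v) :
  block_form (single_block m Av) = Qm v.
Proof.
rewrite (block_formE (N := m.+1)); last first.
  by move=> m' /=; case: eqP => [->|//]; rewrite ltnn.
rewrite big_nat_recr //= big_nat big1 => [|m' /andP[_ mm]].
  rewrite add0r; congr Qm; apply/funext => j; rewrite /block_row /= eqxx.
  by rewrite valK.
have -> : block_row (single_block m Av) m' = 0; last by rewrite block_form0.
by apply/funext => j; rewrite /block_row /= ltn_eqF.
Qed.

(** The Hilbert sum of the spaces of the forms, with [A] acting diagonally. *)
Lemma block_representation :
  exists (H : hilbertType R) (u : op -> H -> H) (iota : blocks -> H),
  [/\ morphism A u, (mnorm A u <= c%:E)%E,
      forall s, hnorm (iota s) ^+ 2 = block_form s,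
      forall k s t, iota (k *: s + t) = k *: iota s + iota t
    & forall a s, A a -> u a (iota s) = iota (block_act a s)].
Proof.
have al a : A a -> linear a := morphism_linear (morphism_inclusion hA) (a := a).
have act_linear a : A a -> linear (block_act a).
  move=> Aa k s t; apply: blocks_eq => m; apply/funext => j; rewrite block_actE //.
  rewrite -[RHS]/(k *: block_act a s m j + block_act a t m j) !block_actE //.
  by apply/funext => h; exact: (al a Aa k (s m j h) (t m j h)).
have act_id s : block_act idfun s = s.
  by apply: blocks_eq => m; apply/funext => j; rewrite block_actE //; exact: (opalg_id hA).
have act_lin k a b s : A a -> A b ->
    block_act (k *: a + b) s = k *: block_act a s + block_act b s.
  move=> Aa Ab; apply: blocks_eq => m; apply/funext => j.
  rewrite block_actE; last exact: (opalg_lin hA).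
  by rewrite -[RHS]/(k *: block_act a s m j + block_act b s m j) !block_actE.
have act_comp a b s : A a -> A b -> block_act (a \o b) s = block_act a (block_act b s).
  move=> Aa Ab; apply: blocks_eq => m; apply/funext => j.
  by rewrite !block_actE //; exact: (opalg_comp hA).
pose hb a s Aa a1 := @block_form_act a s Aa a1.
exists (bidual block_quad : hilbertType R).
exists (bidual_rep hA (Q := block_quad) act_linear act_lin hb).
exists (evaluation block_quad); split.
- exact: bidual_rep_morphism.
- exact: bidual_rep_mnorm.
- by move=> s; rewrite hnorm_evaluation.
- by move=> k s t; rewrite evaluationP.
- by move=> a s Aa; rewrite bidual_rep_evaluation.
Qed.

End BlockSum.

Section UniformFactorization.
Variables (R : realType) (H0 : hilbertType R) (A : set (H0 -> H0)).
Hypothesis hA : unital_operator_algebra A.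
Local Notation toC := (real_complex R).
Local Notation op := (H0 -> H0).

Lemma cbnorm_bound (H : hilbertType R) (u : op -> H -> H) (B : R) : morphism A u ->
  0 <= B -> (cbnorm A u <= B%:E)%E ->
  forall n (x : 'I_n -> 'I_n -> op) zeta, matrix_ball A x ->
  \sum_i hnorm (row_eval u (x i) zeta) ^+ 2 <= B ^+ 2 * \sum_j hnorm (zeta j) ^+ 2.
Proof.
move=> hu B0 hB n x zeta [Ax x1].
have h1 : (mxopnorm (map_mx u (\matrix_(i, j) x i j)) <= B%:E)%E.
  apply: le_trans hB; apply: (@le_trans _ _ (mnorm_amp A u n)).
    apply: ereal_sup_ubound; exists (\matrix_(i, j) x i j) => //=.
    by split=> // i j; rewrite mxE.
  by apply: ereal_sup_ubound; exists n.
have e i : row_eval u (x i) zeta = \sum_j (map_mx u (\matrix_(i, j) x i j)) i j (zeta j).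
  by apply: eq_bigr => j _; rewrite !mxE.
under eq_bigr => i _ do rewrite e.
apply: mxopnorm_bound => // i j; rewrite !mxE; exact: (morphism_linear hu).
Qed.

(** If no [lam] works, each integer [m] provides a form with [m%:R <= \sum_i Q (x i)]. The
block sum of these forms is one morphism of norm at most [c], and its bound on the
matrices [x m], evaluated at the unit rows of the block [m], would exceed all integers. *)
Lemma uniform_factorization (c : R) : 0 <= c -> cb_up_to A c ->
  exists2 lam : R, 0 <= lam &
    forall n (x : 'I_n -> 'I_n -> op), matrix_ball A x -> factorizes A c lam x.
Proof.
move=> c0 hcb; apply: contrapT => hno.
have bad (m : nat) : exists p : {n : nat & ((('I_n -> 'I_n -> op) * (('I_n -> op) -> R))%type)},
    let: existT n (x, Q) := p in
    [/\ matrix_ball A x, quadratic_on (row_in A (n := n)) Q,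
      forall a b, A a -> (opnorm a <= 1)%E -> row_in A b -> Q (fun j => a \o b j) <= c ^+ 2 * Q b,
      \sum_j Q (unit_row j) = 1 & m%:R <= \sum_i Q (x i)].
  apply: contrapT => nex; apply: hno; exists m%:R => // n x hx.
  apply: contrapT => nf; have [Ax _] := hx.
  have [Q [Q1 Q2 Q3 Q4]] := form_of_not_factorizes hA Ax nf.
  by apply: nex; exists (existT _ n (x, Q)).
have [p hp] := choice bad.
pose n m := projT1 (p m).
pose x m : 'I_(n m) -> 'I_(n m) -> op := (projT2 (p m)).1.
pose Q m : ('I_(n m) -> op) -> R := (projT2 (p m)).2.
have hQ m : [/\ matrix_ball A (x m), quadratic_on (row_in A (n := n m)) (Q m),
    forall a b, A a -> (opnorm a <= 1)%E -> row_in A b -> Q m (fun j => a \o b j) <= c ^+ 2 * Q m b,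
    \sum_j Q m (unit_row j) = 1 & m%:R <= \sum_i Q m (x m i)].
  by have := hp m; rewrite /x /Q /n; case: (p m) => k [x' Q'].
have Qquad m : quadratic_on (row_in A (n := n m)) (Q m) by case: (hQ m).
have Qmul m a b : A a -> (opnorm a <= 1)%E -> row_in A b ->
    Q m (fun j => a \o b j) <= c ^+ 2 * Q m b.
  by case: (hQ m) => _ _ h _ _; exact: h.
have [H [u [iota [hu uc iotaN iotaP iotaA]]]] := block_representation hA c0 Qquad Qmul.
have ucb := hcb H u hu uc.
have [B B0 hB] : exists2 B : R, 0 <= B & (cbnorm A u <= B%:E)%E.
  move: ucb; rewrite /completely_bounded; case: (cbnorm A u) => [r| |] // _.
    by exists `|r| => //; rewrite lee_fin ler_norm.
  by exists 0 => //; exact: leNye.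
suff key m : m%:R <= B ^+ 2.
  have := key (Num.truncn (B ^+ 2)).+1; rewrite leNgt => /negP; apply.
  exact: truncnS_gt.
have [hx _ _ Q1 Qx] := hQ m; have [Ax _] := hx.
pose e (j : 'I_(n m)) : blocks hA := single_block hA m (unit_row_in hA j).
pose xi (i : 'I_(n m)) : blocks hA := single_block hA m (Ax i).
have := cbnorm_bound hu B0 hB (fun j => iota (e j)) hx.
have -> : \sum_j hnorm (iota (e j)) ^+ 2 = 1.
  by rewrite -Q1; apply: eq_bigr => j _; rewrite iotaN block_form_single.
rewrite mulr1; apply: le_trans; apply: le_trans Qx _.
apply: ler_sum => i _.
suff -> : row_eval u (x m i) (fun j => iota (e j)) = iota (xi i).
  by rewrite iotaN block_form_single.
have iota0 : iota 0 = 0.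
  apply: (addrI (iota 0)); have := iotaP 1 0 0.
  by rewrite !scale1r !addr0 => /esym.
have iotaD s t : iota (s + t) = iota s + iota t.
  by have := iotaP 1 s t; rewrite !scale1r.
rewrite /row_eval; under eq_bigr => j _ do rewrite iotaA //.
rewrite -(big_morph _ iotaD iota0); congr iota.
apply: blocks_eq => m'; apply/funext => j'.
have block_sumE (T : finType) (f : T -> blocks hA) : (\sum_t f t) m' j' = \sum_t f t m' j'.
  by elim/big_rec2 : _ => // t s r _ <-.
rewrite block_sumE; under eq_bigr => j _ do rewrite block_actE //=.
have x0 j : x m i j \o (0 : op) = 0.
  apply/funext => h; exact: (linear_op0 (morphism_linear (morphism_inclusion hA) (Ax i j))).
rewrite /=; case: eqP => _; last by rewrite big1.
case: insubP => [i' _ _|_]; last by rewrite big1.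
rewrite (bigD1 i') //= big1 => [|j ji]; first by rewrite addr0 /unit_row eqxx.
by rewrite /unit_row eq_sym (negbTE ji).
Qed.

End UniformFactorization.

(** * Complete boundedness and the similarity degree *)

Section CompleteBoundedness.
Variables (R : realType) (H0 : hilbertType R) (A : set (H0 -> H0)).
Hypothesis hA : unital_operator_algebra A.
Local Notation op := (H0 -> H0).

Lemma cbnorm_le (H : hilbertType R) (u : op -> H -> H) (B : R) : 0 <= B ->
  (forall n (x : 'I_n -> 'I_n -> op) zeta, matrix_ball A x ->
    \sum_i hnorm (row_eval u (x i) zeta) ^+ 2 <= B ^+ 2 * \sum_j hnorm (zeta j) ^+ 2) ->
  (cbnorm A u <= B%:E)%E.
Proof.
move=> B0 h; apply: ge_ereal_sup => _ [n _ <-]; apply: ge_ereal_sup => _ [a [/= Aa a1] <-].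
have ha : matrix_ball A (fun i j => a i j).
  split=> //; have -> : \matrix_(i, j) a i j = a by apply/matrixP => i j; rewrite mxE.
  exact: a1.
apply: mxopnorm_le => // zeta; apply: le_trans (h n _ zeta ha).
apply: ler_sum => i _; rewrite le_eqVlt; apply/orP; left; apply/eqP; congr (hnorm _ ^+ 2).
by apply: eq_bigr => j _; rewrite mxE.
Qed.

Lemma exists_large_power (q D : R) : 1 < q -> exists s, D <= q ^+ s.
Proof.
move=> q1; have bern s : 1 + s%:R * (q - 1) <= q ^+ s.
  elim: s => [|s ih]; first by rewrite mul0r addr0.
  have q0 : 0 <= q - 1 by rewrite subr_ge0 ltW.
  have p1 : 1 <= q ^+ s by rewrite exprn_ege1 // ltW.
  have h : q - 1 <= q ^+ s * (q - 1) by rewrite ler_peMl.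
  by rewrite exprSr -natr1; lra.
exists (Num.truncn (D / (q - 1))).+1; apply: le_trans (bern _).
have q0 : 0 < q - 1 by rewrite subr_gt0.
have h : D < (Num.truncn (D / (q - 1))).+1%:R * (q - 1).
  by rewrite -ltr_pdivrMr // truncnS_gt.
by rewrite (le_trans (ltW h)) // lerDr.
Qed.

Lemma polynomial_cb_bound (c : R) : 1 < c -> cb_up_to A c ->
  exists d (K : R), 0 <= K /\ forall (H : hilbertType R) (u : op -> H -> H) (C : R),
    morphism A u -> 1 <= C -> (mnorm A u <= C%:E)%E -> (cbnorm A u <= (K * C ^+ d.+1)%:E)%E.
Proof.
move=> c1 hcb; have c0 : 0 <= c by rewrite ltW // (lt_trans ltr01).
have [lam lam0 hfac] := uniform_factorization hA c0 hcb.
have c2 : 1 < c ^+ 2 by rewrite exprn_egt1.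
have c20 : 0 < c ^+ 2 - 1 by rewrite subr_gt0.
have [s hs] := exists_large_power (4 * lam / (c ^+ 2 - 1)) c2.
exists s, (2 * Num.sqrt (lam * s.+1%:R)).
split=> [|H u C hu C1 uC]; first by rewrite mulr_ge0 ?sqrtr_ge0.
have C0 : 0 <= C := le_trans ler01 C1.
apply: cbnorm_le => [|n x zeta hx].
  by rewrite mulr_ge0 ?exprn_ge0 // mulr_ge0 ?sqrtr_ge0.
have hs' : 4 * lam <= c ^+ 2 ^+ s * (c ^+ 2 - 1) by rewrite -ler_pdivrMr.
apply: le_trans (factorizes_bound hA c1 lam0 hs' hfac zeta hu C1 uC hx) _.
rewrite ler_wpM2r //; first by apply: sumr_ge0 => j _; exact: sqr_ge0.
have -> : C ^+ 2 ^+ s.+1 = (C ^+ s.+1) ^+ 2 by rewrite -!exprM mulnC.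
rewrite !exprMn sqr_sqrtr ?mulr_ge0 ?ler0n //.
by move: (C ^+ s.+1 ^+ 2) => p; rewrite le_eqVlt; apply/orP; left; apply/eqP; ring.
Qed.

Lemma mnorm_ge0 (H : hilbertType R) (u : op -> H -> H) : (0 <= mnorm A u)%E.
Proof.
have id1 : (opnorm (@idfun H0) <= 1)%E.
  by apply: opnorm_le => // h; rewrite expr1n mul1r.
apply: (@le_trans _ _ (opnorm (u idfun))).
  apply: (@le_trans _ _ (hnorm (u idfun 0))%:E); first by rewrite lee_fin hnorm_ge0.
  by apply: ereal_sup_ubound; exists 0 => //=; rewrite hnorm0 ler01.
by apply: ereal_sup_ubound; exists idfun => //=; split=> //; exact: (opalg_id hA).
Qed.

(** The identity has norm at most one, so that a morphism of norm less than one acts on the null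
space. *)
Lemma cbnorm_small (H : hilbertType R) (u : op -> H -> H) (C : R) : morphism A u ->
  0 <= C < 1 -> (mnorm A u <= C%:E)%E -> (cbnorm A u <= 0)%E.
Proof.
move=> hu /andP[C0 C1] uC; apply: cbnorm_le => // n x zeta _.
have id1 : (opnorm (@idfun H0) <= 1)%E.
  by apply: opnorm_le => // h; rewrite expr1n mul1r.
have H00 (h : H) : hnorm h ^+ 2 = 0.
  have := mnorm_bound hu C0 uC (opalg_id hA) id1 h; rewrite (morphism_id hu) /= => hh.
  have C2 : C ^+ 2 < 1 by rewrite exprn_ilt1.
  apply/eqP; rewrite eq_le sqr_ge0 andbT leNgt; apply/negP => hp.
  by move: hh; rewrite -subr_ge0 -[X in _ - X]mul1r -mulrBl pmulr_lge0 // subr_ge0 leNgt C2.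
by rewrite big1 ?expr0n ?mul0r // => i _; rewrite H00.
Qed.

End CompleteBoundedness.

Theorem theorem0p4 (R : realType) (H0 : hilbertType R) (A : set (H0 -> H0))
    (hA : unital_operator_algebra A)
    (hcb : exists2 eps : R, 0 < eps & cb_up_to A (1 + eps)) :
  [/\ forall eps : R, 0 < eps -> cb_up_to A (1 + eps),
      forall (H : hilbertType R) (u : (H0 -> H0) -> (H -> H)),
        bounded_morphism A u -> completely_bounded A u
    & (similarity_degree A < +oo)%E].
Proof.
have [eps eps0 hc] := hcb.
have c1 : 1 < 1 + eps by rewrite ltrDl.
have [d [K [K0 hK]]] := polynomial_cb_bound hA c1 hc.
have bounded_cb (H : hilbertType R) (u : (H0 -> H0) -> (H -> H)) :
    bounded_morphism A u -> completely_bounded A u.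
  move=> [hu u_fin]; have u0 := mnorm_ge0 hA u; move: u_fin u0 (hK H u).
  rewrite /completely_bounded; case: (mnorm A u) => [r| |] // _ r0 h.
  have r1 : r <= Num.max 1 r by rewrite le_max lexx orbT.
  apply: le_lt_trans (h (Num.max 1 r) hu _ _) (ltry _); last by rewrite lee_fin.
  by rewrite le_max lexx.
split=> [e e0 H u hu uC| |]; first 2 last.
- rewrite /similarity_degree; case: asboolP => [[H [u [hu]]]|_]; first by case; exact: bounded_cb.
  apply: (@le_lt_trans _ _ (d.+1%:R%:E : \bar R)); last exact: ltry.
  apply: ereal_inf_lbound; exists d.+1 => //=; exists K => H u [hu u_fin].
  have u0 := mnorm_ge0 hA u; move: u_fin u0 (hK H u) (@cbnorm_small _ _ _ hA H u).
  case: (mnorm A u) => [r| |] // _; rewrite lee_fin => r0 h hsmall.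
  rewrite -EFin_expe -EFinM; have [r1|r1] := leP 1 r; first exact: h.
  apply: (le_trans (hsmall r hu _ _)); rewrite ?r0 ?lee_fin //.
  by rewrite mulr_ge0 ?exprn_ge0.
- by apply: bounded_cb; split=> //; apply: le_lt_trans uC (ltry _).
- exact: bounded_cb.
Qed.
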